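(* Assume that for some constant $\lambda$ there exists a function $T(\beta)=T(\beta;\lambda)$ such that: 1DSt1. $(\beta+\pi/2)^{-1/2}(\beta-5\pi/2)^{-1/2}T(\beta)$ is analytic in the strip $-\pi\le\mathrm{Re}[\beta]\le3\pi$; 1DSt2. $T(\beta)+T(\beta+4\pi)-\lambda T(\beta+2\pi)=0$ (with the branch convention stated in the context); 1DSt3. $|T(\beta)|<C\exp\{\kappa|\mathrm{Im}[\beta]|\}$ for some real constants $C$ and $\kappa$; 1DSt4. $T(\beta)=T(2\pi-\beta)$. Then the function $$\hat W(\alpha_1,\alpha_2)=T(\alpha_1+\alpha_2;\lambda)\,T(\alpha_1-\alpha_2+\pi;\lambda)$$ obeys the stencil formulation StF (see context). Moreover, any finite linear combination of such functions $\hat W$ taken for different $\lambda$ also obeys the stencil formulation StF.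
   Context: Branch convention for 1DSt2: $T$ has branch points at $-\pi/2$ and $5\pi/2$. The reference triplet is $(-\pi,\pi,3\pi)$, where, starting from $\pi$, the point $-\pi$ is reached by a path passing above $-\pi/2$ and the point $3\pi$ by a path passing below $5\pi/2$; other triplets $(\beta,\beta+2\pi,\beta+4\pi)$ are obtained from it by continuity (first along $\mathrm{Re}[\beta]=-\pi$), and the equation is then continued analytically. Sets. $k\in\mathbb C$ has $\mathrm{Re}[k]>0$ and vanishingly small positive imaginary part. $\hat H^{\pm}$ are the upper and lower half-planes; $h^{\pm}$ is the image of the real axis under $\xi\mapsto\pm\sqrt{k^2-\xi^2}$ (root with positive imaginary part), a curve from $\pm k$ to $\pm i\infty$; $H^\pm=\hat H^\pm\setminus h^\pm$. With $\alpha=\arcsin(\xi/k)$ (branch $\arcsin0=0$ continued from the real axis to $H^\pm$), $\Gamma_\alpha$ is the image of the real axis, the curved strips $M^\pm$ are the images of $H^\pm$, and $m^\pm=\Gamma_\alpha\pm\pi/2$ are the images of the two shores of $h^\pm$. $M^+\cup M^-$ contains $\Gamma_\alpha$ (it is the strip between $m^-$ and $m^+$). For a set $A$, $\pi-A=\{\pi-\alpha:\alpha\in A\}$. $\Omega=(M^+\cup M^-)^2$, $\Omega_{+-}=(M^+\cup M^-)\times(\pi-(M^+\cup M^-))$, $\Omega_{-+}=(\pi-(M^+\cup M^-))\times(M^+\cup M^-)$, $\Omega_{--}=(\pi-(M^+\cup M^-))^2$. Stencil formulation StF for $\hat W$: StF1: $[(\alpha_1+\alpha_2+\tfrac{\pi}{2})(\alpha_1+\alpha_2-\tfrac{5\pi}{2})(\alpha_1-\alpha_2-\tfrac{3\pi}{2})(\alpha_1-\alpha_2+\tfrac{3\pi}{2})]^{-1/2}\hat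 W(\alpha_1,\alpha_2)$ is analytic on $\Omega\cup\Omega_{+-}\cup\Omega_{-+}\cup\Omega_{--}$. StF2: $\hat W(\alpha_1,\alpha_2)+\hat W(2\pi+\alpha_1,2\pi+\alpha_2)-\hat W(\alpha_1,2\pi+\alpha_2)-\hat W(2\pi+\alpha_1,\alpha_2)=0$ for $(\alpha_1,\alpha_2)\in m^-\times m^-$. StF3: $\hat W(\alpha_1,\alpha_2)=\hat W(\pi-\alpha_1,\alpha_2)=\hat W(\alpha_1,\pi-\alpha_2)=\hat W(\pi-\alpha_1,\pi-\alpha_2)$ for $(\alpha_1,\alpha_2)\in m^-\times m^-$. StF4: there is a constant $\mu$ such that for real $\alpha_{1,0},\alpha_{2,0},\alpha'_{1,0},\alpha'_{2,0}$ with $(\alpha'_{1,0})^2+(\alpha'_{2,0})^2=1$, chosen such that the points $(\alpha_{1,0}+i\Lambda\alpha'_{1,0},\alpha_{2,0}+i\Lambda\alpha'_{2,0})$ lie in $(M^+\times(M^+\cup M^-))\cup((M^+\cup M^-)\times M^+)$ or $M^-\times M^-$, one has $|\hat W(\alpha_{1,0}+i\Lambda\alpha'_{1,0},\alpha_{2,0}+i\Lambda\alpha'_{2,0})|<\exp\{\mu\Lambda\}$ for large enough $\Lambda>0$. Branches in StF2, StF3: $\hat W$ is single-valued on each of $m^-\times m^-$, $(2\pi+m^-)\times m^-$, $m^-\times(2\pi+m^-)$, $(2\pi+m^-)\times(2\pi+m^-)$; its values there are fixed by continuity from the reference points $(-\tfrac\pi2,-\tfrac\pi2)$, $(\tfrac{3\pi}2,-\tfrac\pi2)$,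 $(-\tfrac\pi2,\tfrac{3\pi}2)$, $(\tfrac{3\pi}2,\tfrac{3\pi}2)$. The first is reached from $(\tfrac\pi2,\tfrac\pi2)$ along a path close to the real plane bypassing the branch line $\alpha_1+\alpha_2=-\pi/2$ on the side $\mathrm{Im}[\alpha_1+\alpha_2]>0$; the others along the images of this path under $\alpha_1\mapsto\pi-\alpha_1$, under $\alpha_2\mapsto\pi-\alpha_2$, and under both. *)

(* Defs.v *)
(* Real numbers from Stdlib, complex numbers from Coquelicot. *)
From Stdlib Require Export Reals.
From Coquelicot Require Export Coquelicot.

Open Scope R_scope.
Open Scope C_scope.

(* Complex differentiability (C-linear Frechet derivative) in a neighbourhood of
   [x]; used both for one variable (U = C) and for two variables (U = C * C). *)
Definition holomorphic_at {U : NormedModule C_AbsRing} (f : U -> C) (x : U) : Prop :=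
  locally x (fun y => ex_filterdiff (V := C_NormedModule) f (locally y)).

(* Paths are parametrized by [0,1]. *)
Definition path (a : R -> C) : Prop :=
  forall t : R, 0 <= t <= 1 -> continuous a t.

(* [r] is a branch of the square root of [f], followed by continuity along a
   path on which [f] does not vanish. *)
Definition root_along (f r : R -> C) : Prop :=
  forall t : R, 0 <= t <= 1 -> continuous r t /\ r t <> 0 /\ r t * r t = f t.

Definition branch_poly (b : C) : C := (b + PI / 2) * (b - 5 * PI / 2).

(* The two-valued function T is a function on the Riemann surface of
   (b + pi/2)^(1/2) (b - 5pi/2)^(1/2):  [T b s] is its value at [b] on the sheet
   where that square root equals [s].  Only pairs with [s * s = branch_poly b]
   are meaningful. *)

Definition strip (b : C) : Prop := (- PI <= Re b <= 3 * PI)%R.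

(* T is given on the strip; the stencil equation continues it through the
   half-planes Im b > 0 and Im b < 0 outside the strip. *)
Definition T_domain (b : C) : Prop := strip b \/ Im b <> 0%R.

(* The sheets [s], [s'], [s''] over -pi, pi, 3pi: from pi, the point -pi is
   reached above -pi/2 and 3pi is reached below 5pi/2. *)
Definition reference_triplet (s s' s'' : C) : Prop :=
  exists u v ru rv : R -> C,
    path u /\ path v /\
    root_along (fun t => branch_poly (u t)) ru /\
    root_along (fun t => branch_poly (v t)) rv /\
    (forall t : R, 0 <= t <= 1 ->
       (T_domain (u t) /\ 0 <= Im (u t)) /\ (T_domain (v t) /\ Im (v t) <= 0)) /\
    (u 0 = PI /\ u 1 = - PI /\ ru 0 = s' /\ ru 1 = s) /\
    (v 0 = PI /\ v 1 = 3 * PI /\ rv 0 = s' /\ rv 1 = s'').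

(* The sheets over b, b + 2pi, b + 4pi obtained by continuity from the reference
   triplet.  A triplet in [T_domain] is either non-real or the reference one, so
   the path leaves -pi into a half-plane (e.g. along Re b = -pi) and can change
   half-plane only through -pi. *)
Definition continued_triplet (b s s' s'' : C) : Prop :=
  exists c r r' r'' : R -> C,
    path c /\ c 0 = - PI /\ c 1 = b /\
    (forall t : R, 0 <= t <= 1 ->
       T_domain (c t) /\ T_domain (c t + 2 * PI) /\ T_domain (c t + 4 * PI)) /\
    root_along (fun t => branch_poly (c t)) r /\
    root_along (fun t => branch_poly (c t + 2 * PI)) r' /\
    root_along (fun t => branch_poly (c t + 4 * PI)) r'' /\
    reference_triplet (r 0) (r' 0) (r'' 0) /\
    r 1 = s /\ r' 1 = s' /\ r'' 1 = s''.

Record OneDSt (lambda : C) (T : C -> C -> C) : Prop := {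
  OneDSt1 : exists A : C -> C,
    (forall b : C, strip b -> holomorphic_at (U := C_NormedModule) A b) /\
    (forall b s : C, strip b -> s * s = branch_poly b -> T b s = s * A b);
  OneDSt2 : forall b s s' s'' : C, continued_triplet b s s' s'' ->
    T b s + T (b + 4 * PI) s'' - lambda * T (b + 2 * PI) s' = 0;
  OneDSt3 : exists C0 kappa : R, forall b s : C,
    strip b -> s * s = branch_poly b ->
    Cmod (T b s) < C0 * exp (kappa * Rabs (Im b));
  (* [branch_poly] is invariant under b |-> 2pi - b, which fixes pi; hence the
     sheets reached from pi along a path and along its image carry the same s. *)
  OneDSt4 : forall b s : C, strip b -> s * s = branch_poly b ->
    T b s = T (2 * PI - b) s
}.

Definition Csin (z : C) : C :=
  ((sin (Re z) * cosh (Im z))%R, (cos (Re z) * sinh (Im z))%R).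

(* The image of a set [X] containing 0 under xi |-> arcsin (xi / k), where arcsin
   is continued from arcsin 0 = 0 along paths xi = k sin a inside [X]. *)
Definition arcsin_image (k : C) (X : C -> Prop) (alpha : C) : Prop :=
  exists a : R -> C,
    path a /\ a 0 = 0 /\ a 1 = alpha /\
    (forall t : R, 0 <= t <= 1 -> X (k * Csin (a t))).

Definition real_axis (xi : C) : Prop := Im xi = 0%R.

Definition h_plus (k w : C) : Prop :=
  (0 < Im w)%R /\ exists xi : R, w * w = k * k - xi * xi.
Definition h_minus (k w : C) : Prop := h_plus k (- w).

(* The half-planes are taken with the real axis, so that M^+ and M^- contain
   Gamma_alpha. *)
Definition H_plus (k w : C) : Prop := (0 <= Im w)%R /\ ~ h_plus k w.
Definition H_minus (k w : C) : Prop := (Im w <= 0)%R /\ ~ h_minus k w.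

Definition Gamma_alpha (k : C) : C -> Prop := arcsin_image k real_axis.
Definition M_plus (k : C) : C -> Prop := arcsin_image k (H_plus k).
Definition M_minus (k : C) : C -> Prop := arcsin_image k (H_minus k).
Definition m_plus (k alpha : C) : Prop := Gamma_alpha k (alpha - PI / 2).
Definition m_minus (k alpha : C) : Prop := Gamma_alpha k (alpha + PI / 2).

Definition M (k alpha : C) : Prop := M_plus k alpha \/ M_minus k alpha.
Definition M_closed (k alpha : C) : Prop :=
  M k alpha \/ m_plus k alpha \/ m_minus k alpha.

Definition flip (e : bool) (alpha : C) : C := if e then PI - alpha else alpha.

(* [Omega k false false], [Omega k false true], [Omega k true false] and
   [Omega k true true] are Omega, Omega_{+-}, Omega_{-+} and Omega_{--}. *)
Definition Omega (k : C) (e1 e2 : bool) (x : C * C) : Prop :=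
  M k (flip e1 (fst x)) /\ M k (flip e2 (snd x)).

Definition Omega_all (k : C) (x : C * C) : Prop :=
  exists e1 e2 : bool, Omega k e1 e2 x.

Definition Omega_all_closed (k : C) (x : C * C) : Prop :=
  exists e1 e2 : bool, M_closed k (flip e1 (fst x)) /\ M_closed k (flip e2 (snd x)).

(* m^- for [e = false] and 2pi + m^- for [e = true] *)
Definition m_shifted (k : C) (e : bool) (alpha : C) : Prop :=
  if e then m_minus k (alpha - 2 * PI) else m_minus k alpha.

(* The square root in StF1 is written as a product [s1 * s2] with
     s1^2 = (a1 + a2 + pi/2) (a1 + a2 - 5pi/2),
     s2^2 = (a1 - a2 + 3pi/2) (a1 - a2 - 3pi/2),
   and [W a1 a2 s1 s2] is the value at (a1, a2) of the multivalued function on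
   the sheet given by [s1] and [s2]. *)
Definition sheet (a1 a2 s1 s2 : C) : Prop :=
  s1 * s1 = branch_poly (a1 + a2) /\ s2 * s2 = branch_poly (a1 - a2 + PI).

Definition lifted_path (a1 a2 r1 r2 : R -> C) : Prop :=
  path a1 /\ path a2 /\
  root_along (fun t => branch_poly (a1 t + a2 t)) r1 /\
  root_along (fun t => branch_poly (a1 t - a2 t + PI)) r2.

(* A path from (pi/2, pi/2) to (-pi/2, -pi/2) passing the branch line
   a1 + a2 = -pi/2 on the side Im (a1 + a2) > 0.  The bound on Re (a1 - a2) keeps
   it from going around a1 - a2 = +-3pi/2. *)
Definition reference_path (k : C) (a1 a2 : R -> C) : Prop :=
  path a1 /\ path a2 /\
  a1 0 = PI / 2 /\ a2 0 = PI / 2 /\ a1 1 = - (PI / 2) /\ a2 1 = - (PI / 2) /\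
  (forall t : R, 0 <= t <= 1 ->
     Omega_all_closed k (a1 t, a2 t) /\
     (0 <= Im (a1 t + a2 t))%R /\ a1 t + a2 t <> - (PI / 2) /\
     (Rabs (Re (a1 t - a2 t)) < 3 * PI / 2)%R).

(* [z1], [z2] is the sheet at (x1, x2) fixed by continuity from the sheet
   [s1], [s2] at (pi/2, pi/2): first along the image of a reference path, then
   inside m^- x m^-, (2pi + m^-) x m^-, m^- x (2pi + m^-) or
   (2pi + m^-) x (2pi + m^-), according to [e1] and [e2]. *)
Definition fixed_sheet (k : C) (e1 e2 : bool) (s1 s2 x1 x2 z1 z2 : C) : Prop :=
  exists a1 a2 r1 r2 c1 c2 p1 p2 : R -> C,
    reference_path k a1 a2 /\
    lifted_path (fun t => flip e1 (a1 t)) (fun t => flip e2 (a2 t)) r1 r2 /\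
    r1 0 = s1 /\ r2 0 = s2 /\
    lifted_path c1 c2 p1 p2 /\
    (forall t : R, 0 <= t <= 1 -> m_shifted k e1 (c1 t) /\ m_shifted k e2 (c2 t)) /\
    c1 0 = flip e1 (a1 1) /\ c2 0 = flip e2 (a2 1) /\ p1 0 = r1 1 /\ p2 0 = r2 1 /\
    c1 1 = x1 /\ c2 1 = x2 /\ p1 1 = z1 /\ p2 1 = z2.

Definition fixed_value (k : C) (W : C -> C -> C -> C -> C) (e1 e2 : bool)
    (s1 s2 x1 x2 w : C) : Prop :=
  exists z1 z2 : C, fixed_sheet k e1 e2 s1 s2 x1 x2 z1 z2 /\ w = W x1 x2 z1 z2.

Record StF (k : C) (W : C -> C -> C -> C -> C) : Prop := {
  (* The values of W on m^- and 2pi + m^- are boundary values, hence the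
     continuity up to the boundary. *)
  StF1 : exists B : C * C -> C,
    (forall x : C * C, Omega_all k x ->
       holomorphic_at (U := prod_NormedModule C_AbsRing C_NormedModule C_NormedModule)
         B x) /\
    (forall x : C * C, Omega_all_closed k x ->
       filterlim B (within (Omega_all_closed k) (locally x)) (locally (B x))) /\
    (forall a1 a2 s1 s2 : C, Omega_all_closed k (a1, a2) -> sheet a1 a2 s1 s2 ->
       W a1 a2 s1 s2 = s1 * s2 * B (a1, a2));
  StF2 : forall s1 s2 : C, sheet (PI / 2) (PI / 2) s1 s2 ->
    forall a1 a2 : C, m_minus k a1 -> m_minus k a2 ->
    forall w w11 w01 w10 : C,
      fixed_value k W false false s1 s2 a1 a2 w ->
      fixed_value k W true true s1 s2 (2 * PI + a1) (2 * PI + a2) w11 ->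
      fixed_value k W false true s1 s2 a1 (2 * PI + a2) w01 ->
      fixed_value k W true false s1 s2 (2 * PI + a1) a2 w10 ->
      w + w11 - w01 - w10 = 0;
  StF3 : forall s1 s2 : C, sheet (PI / 2) (PI / 2) s1 s2 ->
    forall a1 a2 : C, m_minus k a1 -> m_minus k a2 ->
    forall w w11 w01 w10 : C,
      fixed_value k W false false s1 s2 a1 a2 w ->
      fixed_value k W true false s1 s2 (PI - a1) a2 w10 ->
      fixed_value k W false true s1 s2 a1 (PI - a2) w01 ->
      fixed_value k W true true s1 s2 (PI - a1) (PI - a2) w11 ->
      w = w10 /\ w10 = w01 /\ w01 = w11;
  StF4 : exists mu : R, forall a1 a2 d1 d2 : R, (d1 * d1 + d2 * d2 = 1)%R ->
    exists Lambda0 : R, forall Lambda : R, 0 < Lambda -> Lambda0 < Lambda ->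
      forall z1 z2 s1 s2 : C,
        z1 = (a1, (Lambda * d1)%R) -> z2 = (a2, (Lambda * d2)%R) ->
        ((M_plus k z1 /\ M k z2) \/ (M k z1 /\ M_plus k z2)) \/
          (M_minus k z1 /\ M_minus k z2) ->
        sheet z1 z2 s1 s2 ->
        Cmod (W z1 z2 s1 s2) < exp (mu * Lambda)
}.

Definition stencil_product (T : C -> C -> C) (a1 a2 s1 s2 : C) : C :=
  T (a1 + a2) s1 * T (a1 - a2 + PI) s2.

(* Main.v *)
Require Import Defs.
From Stdlib Require Import Lra Ranalysis5 FunctionalExtensionality.

(** Why the product of two one-dimensional solutions solves the stencil problem.

    Write [b = a1 + a2] and [d = a1 - a2 + PI].  Shifting [a1] and [a2] by 2pi,
    together or in opposite directions, moves one of [b], [d] by 4pi or both of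
    them by 2pi, so the four terms of the stencil equation are
    [T b * T d], [T (b + 4pi) * T d], [T (b + 2pi) * T (d - 2pi)] and
    [T (b + 2pi) * T (d + 2pi)].  The one-dimensional equation at [b] turns the
    first two into [lambda * T (b + 2pi) * T d], the one at [d - 2pi] turns the
    last two into the same quantity, and they cancel.  The reflections of [StF3]
    exchange [b] and [d], replace both by their images under [x |-> 2pi - x], or do
    both, and [OneDSt4] gives the symmetry.  The actual work is to justify the
    sheets and the domains.

    Sheets.  Two explicit square roots of [branch_poly] suffice: [outer_root],
    continuous off the real segment between the branch points, and [inner_root],
    continuous off the two real rays outside it.  A root continued along a path is
    a constant sign times either of them as long as the path stays where that one
    is continuous ([sheet_along]).  So the triplets of [OneDSt2] carry the roots
    [outer_root b], [inner_root (b + 2pi)], [- outer_root (b + 4pi)]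
    ([continued_triplet_roots], [stencil_relation]), and the four sheets fixed from
    (pi/2, pi/2) are read off in the same terms ([fixed_sheet_values]).

    Domains.  The curve Gamma is the graph [Re = gamma_re k Im] of an explicit odd
    function bounded by pi/2, and M lies between its translates by -pi/2 and pi/2
    ([M_strip]).  Hence [b] and [d] have real part between -2pi and 4pi, and lie in
    the strip whenever they are real ([Omega_all_closed_sum]): they leave the strip
    only through the half-planes where [OneDSt2] continues [T].

    Continuation.  Write [T b s = s * A b] in the strip.  To the left of it [OneDSt2]
    gives [A b] in terms of [A (b + 2pi)] and [A (b + 4pi)], and to the right
    similarly; on the common line the two expressions agree.  Two functions that
    are complex differentiable at a point of a line and equal along that line have
    the same derivative there, so the glued function is complex differentiable
    ([C_differentiable_glue]); this replaces the identity theorem and yields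
    [OneDSt_extension], from which analyticity ([StF1]) follows.  One step of the
    continuation also multiplies the exponential bound by at most a constant
    ([T_growth]), which gives [StF4].

    Finally every condition of StF is stable under linear combinations
    ([StF_linear]). *)

(** * Continuity of complex-valued functions *)

Ltac C_lra := unfold Re, Im in *; simpl in *; lra.

Lemma C_eq (x y : C) : Re x = Re y -> Im x = Im y -> x = y.
Proof. destruct x, y; simpl; congruence. Qed.

Lemma Cminus_eq_0 (x y : C) : x - y = 0 -> x = y.
Proof. intros e; replace x with (x - y + y) by ring; rewrite e; ring. Qed.

Lemma continuous_C {U : UniformSpace} (f : U -> C) (x : U) :
  continuous (fun y => Re (f y)) x -> continuous (fun y => Im (f y)) x ->
  continuous f x.
Proof.
intros h1 h2.
apply continuous_ext with (fun y => (Re (f y), Im (f y)) : C).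
  intros y; destruct (f y); reflexivity.
apply (continuous_comp_2 (fun y => Re (f y)) (fun y => Im (f y)) (fun a b => (a, b))); auto.
apply continuous_ext with (fun z : R * R => z).
  intros [a b]; reflexivity.
apply continuous_id.
Qed.

Lemma continuous_Re_comp {U : UniformSpace} (f : U -> C) (x : U) :
  continuous f x -> continuous (fun y => Re (f y)) x.
Proof. intros h; apply (continuous_comp f fst); [exact h | apply continuous_fst]. Qed.

Lemma continuous_Im_comp {U : UniformSpace} (f : U -> C) (x : U) :
  continuous f x -> continuous (fun y => Im (f y)) x.
Proof. intros h; apply (continuous_comp f snd); [exact h | apply continuous_snd]. Qed.

Lemma continuous_Cplus {U : UniformSpace} (f g : U -> C) (x : U) :
  continuous f x -> continuous g x ->
  continuous (fun y => f y + g y) x.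
Proof.
intros hf hg; apply continuous_C; simpl;
 apply (continuous_plus (V := R_NormedModule)); auto using continuous_Re_comp, continuous_Im_comp.
all: first [now apply continuous_Re_comp | now apply continuous_Im_comp].
Qed.

Lemma continuous_Copp {U : UniformSpace} (f : U -> C) (x : U) :
  continuous f x -> continuous (fun y => - f y) x.
Proof.
intros hf; apply continuous_C; simpl;
 apply (continuous_opp (V := R_NormedModule));
 first [now apply continuous_Re_comp | now apply continuous_Im_comp].
Qed.

Lemma continuous_Cminus {U : UniformSpace} (f g : U -> C) (x : U) :
  continuous f x -> continuous g x ->
  continuous (fun y => f y - g y) x.
Proof. intros hf hg; apply continuous_Cplus; [|apply continuous_Copp]; auto. Qed.

Lemma continuous_Cconj {U : UniformSpace} (f : U -> C) (x : U) :
  continuous f x -> continuous (fun y => Cconj (f y)) x.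
Proof.
intros hf; apply continuous_C; simpl.
  now apply continuous_Re_comp.
now apply (continuous_opp (V := R_NormedModule)), continuous_Im_comp.
Qed.

Lemma continuous_Cmult {U : UniformSpace} (f g : U -> C) (x : U) :
  continuous f x -> continuous g x ->
  continuous (fun y => f y * g y) x.
Proof.
intros hf hg.
assert (h1 := continuous_Re_comp _ _ hf). assert (h2 := continuous_Im_comp _ _ hf).
assert (h3 := continuous_Re_comp _ _ hg). assert (h4 := continuous_Im_comp _ _ hg).
apply continuous_C; simpl.
  apply (continuous_minus (V := R_NormedModule)); now apply (continuous_mult (K := R_AbsRing)).
apply (continuous_plus (V := R_NormedModule)); now apply (continuous_mult (K := R_AbsRing)).
Qed.

Lemma continuous_Cinv {U : UniformSpace} (f : U -> C) (x : U) :
  continuous f x -> f x <> 0 ->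
  continuous (fun y => / f y) x.
Proof.
intros hf nz.
assert (h1 := continuous_Re_comp _ _ hf). assert (h2 := continuous_Im_comp _ _ hf).
assert (hd : continuous (fun y => (/ (Re (f y) ^ 2 + Im (f y) ^ 2))%R) x).
  apply (continuous_comp (fun y => (Re (f y) ^ 2 + Im (f y) ^ 2)%R) Rinv).
    apply (continuous_plus (V := R_NormedModule));
    (apply (continuous_mult (K := R_AbsRing)); auto;
     apply (continuous_mult (K := R_AbsRing)); auto; apply continuous_const).
  apply continuous_Rinv.
  intros h; apply nz; apply C_eq; simpl; nra.
apply continuous_C; simpl; unfold Rdiv.
  apply (continuous_mult (K := R_AbsRing)); auto.
apply (continuous_mult (K := R_AbsRing)); auto.
now apply (continuous_opp (V := R_NormedModule)).
Qed.

Lemma continuous_Cdiv {U : UniformSpace} (f g : U -> C) (x : U) :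
  continuous f x -> continuous g x -> g x <> 0 ->
  continuous (fun y => f y / g y) x.
Proof. intros; apply continuous_Cmult; auto; now apply continuous_Cinv. Qed.

Lemma continuous_Cmod {U : UniformSpace} (f : U -> C) (x : U) :
  continuous f x -> continuous (fun y => Cmod (f y)) x.
Proof.
intros hf.
assert (h1 := continuous_Re_comp _ _ hf). assert (h2 := continuous_Im_comp _ _ hf).
apply (continuous_comp (fun y => (fst (f y) ^ 2 + snd (f y) ^ 2)%R) sqrt).
  apply (continuous_plus (V := R_NormedModule));
  (apply (continuous_mult (K := R_AbsRing)); auto;
   apply (continuous_mult (K := R_AbsRing)); auto; apply continuous_const).
apply continuous_sqrt.
Qed.
Lemma continuous_if {U V : UniformSpace} (h : U -> R) (f g : U -> V) (c : R) (x : U) :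
  continuous h x ->
  (c <= h x -> continuous f x) -> (h x <= c -> continuous g x) ->
  (h x = c -> f x = g x) ->
  continuous (fun y => if Rle_dec c (h y) then f y else g y) x.
Proof.
intros hh hf hg e.
destruct (Rtotal_order (h x) c) as [l|[l|l]].
- apply continuous_ext_loc with g; [|apply hg; lra].
  assert (n := hh (fun z => z < c) (open_lt c _ l)); unfold filtermap in n; revert n.
  apply filter_imp; intros y; destruct (Rle_dec c (h y)); auto; lra.
- intros P HP; unfold filtermap.
  destruct (Rle_dec c (h x)) in HP; [|lra].
  assert (h1 := hf (Req_le _ _ (eq_sym l)) P HP).
  rewrite (e l) in HP.
  assert (h2 := hg (Req_le _ _ l) P HP).
  unfold filtermap in h1, h2; assert (n := filter_and _ _ h1 h2); revert n.
  apply filter_imp; intros y [a b]; destruct (Rle_dec c (h y)); auto.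
- apply continuous_ext_loc with f; [|apply hf; lra].
  assert (n := hh (fun z => c < z) (open_gt c _ l)); unfold filtermap in n; revert n.
  apply filter_imp; intros y; destruct (Rle_dec c (h y)); auto; lra.
Qed.

(** * Square roots of the branch polynomial *)

Lemma branch_polyE b :
  branch_poly b = (b + RtoC (PI / 2)) * (b - RtoC (5 * PI / 2)).
Proof. unfold branch_poly; rewrite !RtoC_div, RtoC_mult by lra; reflexivity. Qed.

Lemma branch_poly_zero b : branch_poly b = 0 ->
  Im b = 0%R /\ (Re b = - PI / 2 \/ Re b = 5 * PI / 2)%R.
Proof.
rewrite branch_polyE; intros h.
destruct (Ceq_dec (b + RtoC (PI / 2)) 0) as [e|n].
  assert (e1 := f_equal Re e); assert (e2 := f_equal Im e).
  split; [|left]; C_lra.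
destruct (Ceq_dec (b - RtoC (5 * PI / 2)) 0) as [e|n'].
  assert (e1 := f_equal Re e); assert (e2 := f_equal Im e).
  split; [|right]; C_lra.
now elim (Cmult_neq_0 _ _ n n').
Qed.

Lemma branch_poly_conj b : branch_poly (Cconj b) = Cconj (branch_poly b).
Proof. rewrite !branch_polyE; apply C_eq; simpl; ring. Qed.

(** The square root of [(Re z, |Im z|)] with both parts nonnegative.  Continuous on
    all of C, it is the root of [z] for [z] in the closed upper half-plane, and its
    conjugate is a root of [z] in the closed lower one. *)
Definition half_plane_root (z : C) : C :=
  (sqrt ((Cmod z + Re z) / 2), sqrt ((Cmod z - Re z) / 2)).

Lemma half_plane_root_sqr z :
  half_plane_root z * half_plane_root z = (Re z, Rabs (Im z)).
Proof.
assert (h := re_le_Cmod z).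
assert (h1 : 0 <= (Cmod z + Re z) / 2) by (revert h; unfold Rabs; destruct Rcase_abs; lra).
assert (h2 : 0 <= (Cmod z - Re z) / 2) by (revert h; unfold Rabs; destruct Rcase_abs; lra).
apply C_eq; unfold half_plane_root; simpl.
  rewrite !sqrt_sqrt by assumption; lra.
rewrite <- !sqrt_mult by assumption.
replace ((Cmod z + Re z) / 2 * ((Cmod z - Re z) / 2))%R with (Rsqr (Im z / 2)).
  replace ((Cmod z - Re z) / 2 * ((Cmod z + Re z) / 2))%R with (Rsqr (Im z / 2)).
    rewrite !sqrt_Rsqr_abs; unfold Rdiv; rewrite !Rabs_mult, (Rabs_right (/ 2)); lra.
all: assert (e := Cmod2_alt z); unfold Rsqr; nra.
Qed.

Lemma continuous_half_plane_root {U : UniformSpace} (f : U -> C) x :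
  continuous f x -> continuous (fun y => half_plane_root (f y)) x.
Proof.
intros hf.
assert (h1 := continuous_Re_comp _ _ hf). assert (h2 := continuous_Cmod _ _ hf).
apply continuous_C; simpl.
  apply (continuous_comp (fun y => ((Cmod (f y) + Re (f y)) / 2)%R) sqrt); [|apply continuous_sqrt].
  apply (continuous_mult (K := R_AbsRing)); [|apply continuous_const].
  now apply (continuous_plus (V := R_NormedModule)).
apply (continuous_comp (fun y => ((Cmod (f y) - Re (f y)) / 2)%R) sqrt); [|apply continuous_sqrt].
apply (continuous_mult (K := R_AbsRing)); [|apply continuous_const].
now apply (continuous_minus (V := R_NormedModule)).
Qed.

Definition upper_root (b : C) : C :=
  half_plane_root (b + RtoC (PI / 2)) * half_plane_root (b - RtoC (5 * PI / 2)).

Lemma upper_root_sqr b : 0 <= Im b -> upper_root b * upper_root b = branch_poly b.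
Proof.
intros h; unfold upper_root.
set (u := half_plane_root _); set (v := half_plane_root _).
replace (u * v * (u * v)) with ((u * u) * (v * v)) by ring.
unfold u, v; rewrite !half_plane_root_sqr, branch_polyE; simpl.
rewrite !Rabs_right by C_lra.
f_equal; apply C_eq; simpl; ring.
Qed.

Lemma lower_root_sqr b :
  Im b <= 0 -> Cconj (upper_root b) * Cconj (upper_root b) = branch_poly b.
Proof.
intros h.
assert (e : upper_root b = upper_root (Cconj b)).
  unfold upper_root, half_plane_root.
  assert (c : forall r, Cmod (Cconj b + RtoC r) = Cmod (b + RtoC r)).
    intros r; rewrite <- (Cmod_conj (b + r)); f_equal; apply C_eq; simpl; ring.
  unfold Cminus; rewrite <- !RtoC_opp, !c; reflexivity.
rewrite <- Cmult_conj, e, upper_root_sqr by C_lra.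
rewrite branch_poly_conj; apply C_eq; simpl; ring.
Qed.

Lemma half_plane_root_pos z : Im z = 0%R -> 0 <= Re z -> Im (half_plane_root z) = 0%R.
Proof.
intros h1 h2; simpl; replace z with (RtoC (Re z)) by (apply C_eq; C_lra).
rewrite Cmod_R, Rabs_right by C_lra; simpl.
replace ((Re z - Re z) / 2)%R with 0%R by lra; apply sqrt_0.
Qed.

Lemma half_plane_root_neg z : Im z = 0%R -> Re z <= 0 -> Re (half_plane_root z) = 0%R.
Proof.
intros h1 h2; simpl; replace z with (RtoC (Re z)) by (apply C_eq; C_lra).
rewrite Cmod_R, Rabs_left1 by C_lra; simpl.
replace ((- Re z + Re z) / 2)%R with 0%R by lra; apply sqrt_0.
Qed.

Lemma upper_root_outer b : Im b = 0%R ->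
  (Re b <= - PI / 2 \/ 5 * PI / 2 <= Re b)%R -> Im (upper_root b) = 0%R.
Proof.
intros h1 h2; assert (p := PI_RGT_0); unfold upper_root; rewrite im_mult.
destruct h2 as [h2|h2].
  rewrite (half_plane_root_neg (b + _)), (half_plane_root_neg (b - _)); C_lra.
rewrite (half_plane_root_pos (b + _)), (half_plane_root_pos (b - _)); C_lra.
Qed.

Lemma upper_root_inner b : Im b = 0%R ->
  (- PI / 2 <= Re b <= 5 * PI / 2)%R -> Re (upper_root b) = 0%R.
Proof.
intros h1 h2; assert (p := PI_RGT_0); unfold upper_root; rewrite re_mult.
rewrite (half_plane_root_pos (b + _)), (half_plane_root_neg (b - _)); C_lra.
Qed.

(** The reflection about pi exchanges the factors at the two branch points, and
    [half_plane_root (- z)] is [Ci * Cconj (half_plane_root z)]. *)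
Lemma upper_root_reflect b : upper_root (2 * PI - b) = - Cconj (upper_root b).
Proof.
assert (s : forall z, half_plane_root (- z) = Ci * Cconj (half_plane_root z)).
  intros z; unfold half_plane_root; rewrite Cmod_opp, re_opp.
  unfold Rminus; rewrite Ropp_involutive.
  apply C_eq; simpl; ring.
unfold upper_root; rewrite Cmult_conj.
replace (2 * PI - b + RtoC (PI / 2)) with (- (b - RtoC (5 * PI / 2)))
  by (apply C_eq; simpl; field).
replace (2 * PI - b - RtoC (5 * PI / 2)) with (- (b + RtoC (PI / 2)))
  by (apply C_eq; simpl; field).
rewrite !s; set (u := Cconj _); set (v := Cconj _).
apply C_eq; simpl; ring.
Qed.

(** The roots on the two half-planes are real on the rays outside the branch points
    and imaginary on the segment between them.  Conjugation therefore glues them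
    across the rays, and minus conjugation across the segment. *)
Definition outer_root (b : C) : C :=
  if Rle_dec 0 (Im b) then upper_root b else Cconj (upper_root b).

Definition inner_root (b : C) : C :=
  if Rle_dec 0 (Im b) then upper_root b else - Cconj (upper_root b).

Lemma outer_root_sqr b : outer_root b * outer_root b = branch_poly b.
Proof.
unfold outer_root; destruct (Rle_dec 0 (Im b)).
  now apply upper_root_sqr.
apply lower_root_sqr; lra.
Qed.

Lemma inner_root_sqr b : inner_root b * inner_root b = branch_poly b.
Proof.
unfold inner_root; destruct (Rle_dec 0 (Im b)).
  now apply upper_root_sqr.
rewrite <- lower_root_sqr by lra; ring.
Qed.

Definition off_segment (b : C) : Prop :=
  Im b <> 0%R \/ (Re b < - PI / 2)%R \/ (5 * PI / 2 < Re b)%R.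
Definition off_rays (b : C) : Prop :=
  Im b <> 0%R \/ (- PI / 2 < Re b < 5 * PI / 2)%R.

Lemma off_segment_neq b : off_segment b -> branch_poly b <> 0.
Proof.
intros h e; assert (p := PI_RGT_0).
destruct (branch_poly_zero b e) as [i [r|r]]; destruct h as [h|h]; tauto || lra.
Qed.

Lemma off_rays_neq b : off_rays b -> branch_poly b <> 0.
Proof.
intros h e; assert (p := PI_RGT_0).
destruct (branch_poly_zero b e) as [i [r|r]]; destruct h as [h|h]; tauto || lra.
Qed.

Lemma outer_root_reflect b : off_segment b -> outer_root (2 * PI - b) = - outer_root b.
Proof.
intros h; unfold outer_root; rewrite !upper_root_reflect.
replace (Im (2 * PI - b)) with (- Im b)%R by (unfold Im; simpl; ring).
destruct (Rtotal_order (Im b) 0) as [l|[l|l]]; repeat destruct Rle_dec; try lra.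
- reflexivity.
- assert (e := upper_root_outer b l).
  assert (e' : Im (upper_root b) = 0%R) by (apply e; destruct h; tauto || lra).
  revert e'; destruct (upper_root b) as [u v]; simpl; intros ->; apply C_eq; simpl; ring.
- destruct (upper_root b); apply C_eq; simpl; ring.
Qed.

Lemma inner_root_reflect b : off_rays b -> inner_root (2 * PI - b) = inner_root b.
Proof.
intros h; unfold inner_root; rewrite !upper_root_reflect.
replace (Im (2 * PI - b)) with (- Im b)%R by (unfold Im; simpl; ring).
destruct (Rtotal_order (Im b) 0) as [l|[l|l]]; repeat destruct Rle_dec; try lra.
- reflexivity.
- assert (e := upper_root_inner b l).
  assert (e' : Re (upper_root b) = 0%R) by (apply e; destruct h; tauto || lra).
  revert e'; destruct (upper_root b) as [u v]; simpl; intros ->; apply C_eq; simpl; ring.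
- destruct (upper_root b); apply C_eq; simpl; ring.
Qed.
Lemma continuous_upper_root b : continuous upper_root b.
Proof.
apply continuous_Cmult; apply continuous_half_plane_root.
  apply continuous_Cplus; [apply continuous_id | apply continuous_const].
apply continuous_Cminus; [apply continuous_id | apply continuous_const].
Qed.

Lemma continuous_outer_root b : off_segment b -> continuous outer_root b.
Proof.
intros h; apply continuous_if.
- apply continuous_Im_comp, continuous_id.
- intros _; apply continuous_upper_root.
- intros _; apply continuous_Cconj, continuous_upper_root.
- intros e; assert (e' : Im (upper_root b) = 0%R).
    apply upper_root_outer; [assumption|]; destruct h; tauto || lra.
  revert e'; destruct (upper_root b) as [u v]; simpl; intros ->.
  apply C_eq; simpl; ring.
Qed.

Lemma continuous_inner_root b : off_rays b -> continuous inner_root b.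
Proof.
intros h; apply continuous_if.
- apply continuous_Im_comp, continuous_id.
- intros _; apply continuous_upper_root.
- intros _; apply continuous_Copp, continuous_Cconj, continuous_upper_root.
- intros e; assert (e' : Re (upper_root b) = 0%R).
    apply upper_root_inner; [assumption|]; destruct h; tauto || lra.
  revert e'; destruct (upper_root b) as [u v]; simpl; intros ->.
  apply C_eq; simpl; ring.
Qed.

(** * Following a square root along a path *)

(** Intermediate value theorem, in the form used to follow a path. *)
Lemma positive_along (h : R -> R) :
  (forall t, 0 <= t <= 1 -> continuous h t) ->
  (forall t, 0 <= t <= 1 -> h t <> 0%R) ->
  0 < h 0%R -> forall t, 0 <= t <= 1 -> 0 < h t.
Proof.
intros hc hn h0 t ht.
destruct (Rlt_le_dec 0 (h t)) as [l|l]; [assumption|].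
assert (n := hn t ht).
assert (t0 : 0 < t) by (destruct (Req_dec t 0) as [->|]; lra).
destruct (IVT_interv (fun x => (- h x)%R) 0 t) as [z [hz ez]]; try lra.
- intros a ha; apply continuity_pt_filterlim.
  apply (continuous_opp (V := R_NormedModule)), hc; lra.
- elim (hn z); lra.
Qed.

(** The quotient of the two roots is continuous with values 1 and -1, hence
    constant. *)
Lemma square_root_along_unique (f g : R -> C) :
  (forall t, 0 <= t <= 1 -> continuous f t) ->
  (forall t, 0 <= t <= 1 -> continuous g t) ->
  (forall t, 0 <= t <= 1 -> f t <> 0) ->
  (forall t, 0 <= t <= 1 -> f t * f t = g t * g t) ->
  f 0%R = g 0%R -> f 1%R = g 1%R.
Proof.
intros hf hg nz sq e0.
assert (two : forall t, 0 <= t <= 1 -> g t / f t = 1 \/ g t / f t = - (1)).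
  intros t ht; assert (n := nz t ht).
  destruct (Ceq_dec (g t / f t - 1) 0) as [e|d].
    left; replace (g t / f t) with (g t / f t - 1 + 1) by ring; rewrite e; ring.
  destruct (Ceq_dec (g t / f t + 1) 0) as [e|d'].
    right; replace (g t / f t) with (g t / f t + 1 - 1) by ring; rewrite e; ring.
  elim (Cmult_neq_0 _ _ d d').
  replace ((g t / f t - 1) * (g t / f t + 1))
    with ((g t * g t - f t * f t) / (f t * f t)) by (field; assumption).
  rewrite (sq t ht); unfold Cdiv; ring.
assert (pos : 0 < Re (g 1%R / f 1%R)).
  apply (positive_along (fun t => Re (g t / f t))); try lra.
  - intros t ht; apply continuous_Re_comp, continuous_Cdiv; auto.
  - intros t ht; destruct (two t ht) as [e|e]; rewrite e; simpl; lra.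
  - rewrite <- e0; replace (f 0%R / f 0%R) with (RtoC 1) by (field; apply nz; lra).
    simpl; lra.
destruct (two 1%R) as [e|e]; try lra.
  replace (g 1%R) with (g 1%R / f 1%R * f 1%R) by (field; apply nz; lra).
  rewrite e; ring.
rewrite e in pos; simpl in pos; lra.
Qed.

Lemma sheet_along (q : C -> C) (c r : R -> C) (eps : C) :
  path c -> root_along (fun t => branch_poly (c t)) r -> eps * eps = 1 ->
  (forall t, 0 <= t <= 1 -> continuous q (c t) /\ q (c t) * q (c t) = branch_poly (c t)) ->
  r 0%R = eps * q (c 0%R) -> r 1%R = eps * q (c 1%R).
Proof.
intros hc hr he hq; apply (square_root_along_unique r (fun t => eps * q (c t))).
- intros t ht; apply hr, ht.
- intros t ht; apply continuous_Cmult; [apply continuous_const|].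
  apply (continuous_comp c q); [apply hc, ht | apply hq, ht].
- intros t ht; apply hr, ht.
- intros t ht; destruct (hr t ht) as [_ [_ ->]]; destruct (hq t ht) as [_ e].
  replace (eps * q (c t) * (eps * q (c t))) with (eps * eps * (q (c t) * q (c t))) by ring.
  rewrite he, e; ring.
Qed.

Lemma upper_sheet_along (c r : R -> C) (eps : C) :
  path c -> root_along (fun t => branch_poly (c t)) r -> eps * eps = 1 ->
  (forall t, 0 <= t <= 1 -> 0 <= Im (c t)) ->
  r 0%R = eps * upper_root (c 0%R) -> r 1%R = eps * upper_root (c 1%R).
Proof.
intros hc hr he hi; apply sheet_along; auto; intros t ht; split.
  apply continuous_upper_root.
now apply upper_root_sqr, hi.
Qed.

Lemma lower_sheet_along (c r : R -> C) (eps : C) :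
  path c -> root_along (fun t => branch_poly (c t)) r -> eps * eps = 1 ->
  (forall t, 0 <= t <= 1 -> Im (c t) <= 0) ->
  r 0%R = eps * Cconj (upper_root (c 0%R)) -> r 1%R = eps * Cconj (upper_root (c 1%R)).
Proof.
intros hc hr he hi; apply (sheet_along (fun b => Cconj (upper_root b))); auto; intros t ht; split.
  apply continuous_Cconj, continuous_upper_root.
now apply lower_root_sqr, hi.
Qed.

Lemma outer_sheet_along (c r : R -> C) (eps : C) :
  path c -> root_along (fun t => branch_poly (c t)) r -> eps * eps = 1 ->
  (forall t, 0 <= t <= 1 -> off_segment (c t)) ->
  r 0%R = eps * outer_root (c 0%R) -> r 1%R = eps * outer_root (c 1%R).
Proof.
intros hc hr he hi; apply sheet_along; auto; intros t ht; split.
  apply continuous_outer_root; auto.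
apply outer_root_sqr.
Qed.

Lemma inner_sheet_along (c r : R -> C) (eps : C) :
  path c -> root_along (fun t => branch_poly (c t)) r -> eps * eps = 1 ->
  (forall t, 0 <= t <= 1 -> off_rays (c t)) ->
  r 0%R = eps * inner_root (c 0%R) -> r 1%R = eps * inner_root (c 1%R).
Proof.
intros hc hr he hi; apply sheet_along; auto; intros t ht; split.
  apply continuous_inner_root; auto.
apply inner_root_sqr.
Qed.

Lemma outer_root_mPI : upper_root (- PI) = outer_root (- PI).
Proof.
unfold outer_root; destruct Rle_dec as [|n]; [reflexivity | elim n; simpl; lra].
Qed.

Lemma outer_root_3PI : Cconj (upper_root (3 * PI)) = outer_root (3 * PI).
Proof.
unfold outer_root; destruct Rle_dec as [|n]; [|elim n; simpl; lra].
assert (p := PI_RGT_0).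
assert (e := upper_root_outer (3 * PI)).
revert e; destruct (upper_root (3 * PI)) as [u v]; simpl; intros e.
rewrite e by lra; apply C_eq; simpl; ring.
Qed.

Lemma inner_root_PI : inner_root PI = upper_root PI.
Proof.
unfold inner_root; destruct Rle_dec as [|n]; [reflexivity | elim n; simpl; lra].
Qed.

Lemma conj_upper_root_PI : Cconj (upper_root PI) = - upper_root PI.
Proof.
assert (p := PI_RGT_0).
assert (e := upper_root_inner PI).
revert e; destruct (upper_root PI) as [u v]; simpl; intros e.
rewrite e by lra; apply C_eq; simpl; ring.
Qed.
(** * The curve Gamma and the strips around it *)

(** With [alpha = x + iy], the condition [Im (k * sin alpha) = 0] reads
    [Im k * sin x * cosh y + Re k * cos x * sinh y = 0]; this is its solution with
    [|x| < pi/2]. *)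
Definition gamma_re (k : C) (y : R) : R := (- atan (Re k / Im k * (sinh y / cosh y)))%R.

Lemma gamma_re_opp k y : gamma_re k (- y) = (- gamma_re k y)%R.
Proof.
unfold gamma_re; rewrite <- (atan_opp (Re k / Im k * (sinh y / cosh y))).
do 2 f_equal; unfold sinh, cosh; rewrite Ropp_involutive; unfold Rdiv.
rewrite (Rplus_comm (exp (- y))); ring.
Qed.

Lemma gamma_re_bound k y : - (PI / 2) < gamma_re k y < PI / 2.
Proof.
unfold gamma_re; destruct (atan_bound (Re k / Im k * (sinh y / cosh y))); lra.
Qed.

Lemma cosh_pos y : 0 < cosh y.
Proof. unfold cosh; assert (a := exp_pos y); assert (b := exp_pos (- y)); lra. Qed.

Lemma continuous_gamma_re k y : continuous (gamma_re k) y.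
Proof.
apply (continuous_opp (V := R_NormedModule)), continuous_atan_comp.
apply (continuous_mult (K := R_AbsRing)); [apply continuous_const|].
apply continuity_pt_filterlim, continuity_pt_div.
- apply derivable_continuous_pt, derivable_pt_sinh.
- apply derivable_continuous_pt, derivable_pt_cosh.
- assert (h := cosh_pos y); lra.
Qed.

Lemma Im_k_Csin k x y :
  Im (k * Csin (x, y)) = (Im k * (sin x * cosh y) + Re k * (cos x * sinh y))%R.
Proof. unfold Csin; rewrite im_mult; simpl; ring. Qed.

Lemma gamma_re_spec k y : 0 < Im k ->
  0 < cos (gamma_re k y) /\
  (Im k * (sin (gamma_re k y) * cosh y) = - (Re k * (cos (gamma_re k y) * sinh y)))%R.
Proof.
intros hk; assert (b := gamma_re_bound k y); assert (p := cosh_pos y).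
assert (c : 0 < cos (gamma_re k y)) by (apply cos_gt_0; lra).
split; [assumption|].
assert (t : tan (gamma_re k y) = (- (Re k / Im k * (sinh y / cosh y)))%R).
  unfold gamma_re; rewrite tan_neg, tan_atan; reflexivity.
unfold tan in t; apply (f_equal (fun u => u * cos (gamma_re k y))%R) in t.
replace (sin (gamma_re k y)) with (sin (gamma_re k y) / cos (gamma_re k y) * cos (gamma_re k y))%R
  by (field; lra).
rewrite t; field; lra.
Qed.

Lemma gamma_re_unique k x y : 0 < Im k -> - (PI / 2) < x < PI / 2 ->
  Im (k * Csin (x, y)) = 0%R -> x = gamma_re k y.
Proof.
intros hk hx; rewrite Im_k_Csin; intros e.
assert (p := cosh_pos y); assert (c : 0 < cos x) by (apply cos_gt_0; lra).
unfold gamma_re; rewrite <- atan_opp, <- (atan_tan x hx); f_equal.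
unfold tan; apply Rmult_eq_reg_r with (Im k * cos x * cosh y)%R.
  replace (sin x / cos x * (Im k * cos x * cosh y))%R with (Im k * (sin x * cosh y))%R
    by (field; lra).
  replace (- (Re k / Im k * (sinh y / cosh y)) * (Im k * cos x * cosh y))%R
    with (- (Re k * (cos x * sinh y)))%R by (field; lra).
  lra.
assert (0 < Im k * cos x) by nra; nra.
Qed.

(** Confines a path to a curved strip once it is known not to meet its sides. *)
Lemma confined_along (h : R -> R) (c : R) :
  (forall t, 0 <= t <= 1 -> continuous h t) -> h 0%R = 0%R -> 0 < c ->
  (forall t, 0 <= t <= 1 -> h t <> c /\ h t <> (- c)%R) ->
  forall t, 0 <= t <= 1 -> - c < h t < c.
Proof.
intros hc h0 c0 hn t ht.
assert (h1 : 0 < c - h t).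
  apply (positive_along (fun t => c - h t)%R); try assumption.
  - intros u hu; apply (continuous_minus (V := R_NormedModule)); auto; apply continuous_const.
  - intros u hu e; destruct (hn u hu) as [n1 n2]; first [apply n1; lra | apply n2; lra].
  - lra.
assert (h2 : 0 < c + h t).
  apply (positive_along (fun t => c + h t)%R); try assumption.
  - intros u hu; apply (continuous_plus (V := R_NormedModule)); auto; apply continuous_const.
  - intros u hu e; destruct (hn u hu) as [n1 n2]; first [apply n1; lra | apply n2; lra].
  - lra.
lra.
Qed.

(** A path from 0 along which [k * sin] is real never meets [Re = pi/2] or
    [Re = - pi/2], where [Im (k * sin)] is [Im k * cosh] or its opposite. *)
Lemma Gamma_alpha_re k alpha : 0 < Im k -> Gamma_alpha k alpha ->
  Re alpha = gamma_re k (Im alpha).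
Proof.
intros hk [a [ha [a0 [a1 hX]]]]; assert (p := PI_RGT_0).
assert (b : forall t, 0 <= t <= 1 -> - (PI / 2) < Re (a t) < PI / 2).
  apply confined_along; try lra.
  - intros t ht; apply continuous_Re_comp, ha, ht.
  - rewrite a0; reflexivity.
  - intros t ht; assert (h := hX t ht); unfold real_axis in h.
    destruct (a t) as [x y]; rewrite Im_k_Csin in h.
    assert (q := Rmult_lt_0_compat _ _ hk (cosh_pos y)).
    split; intros e; simpl in e; rewrite e in h.
      rewrite sin_PI2, cos_PI2 in h; lra.
    rewrite sin_neg, cos_neg, sin_PI2, cos_PI2 in h; lra.
assert (h := hX 1%R ltac:(lra)); assert (b1 := b 1%R ltac:(lra)).
rewrite a1 in h, b1; apply gamma_re_unique; try assumption.
Qed.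

(** If [k * sin gamma] is a real number [xi] then
    [(k * sin (gamma + pi/2))^2 = (k * cos gamma)^2 = k^2 - xi^2]: the translates of
    Gamma by pi/2 and - pi/2 are sent to the two cuts. *)
Lemma h_plus_shore k y : 0 < Im k ->
  h_plus k (k * Csin (gamma_re k y + PI / 2, y)%R) /\
  Csin (gamma_re k y - PI / 2, y)%R = - Csin (gamma_re k y + PI / 2, y)%R.
Proof.
intros hk; destruct (gamma_re_spec k y hk) as [c e]; assert (q := cosh_pos y).
assert (sh : Csin (gamma_re k y + PI / 2, y)%R
  = ((cos (gamma_re k y) * cosh y)%R, (- sin (gamma_re k y) * sinh y)%R)).
  unfold Csin; simpl; rewrite sin_plus, cos_plus, sin_PI2, cos_PI2.
  apply C_eq; simpl; ring.
split.
  split.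
    rewrite sh, im_mult; simpl.
    (* After this multiplication, [gamma_re_spec] turns the expression into a nonnegative
       square times a cosine plus a positive term. *)
    apply Rmult_lt_reg_l with (Im k * cosh y)%R; [nra|].
    replace (Im k * cosh y * (Re k * (- sin (gamma_re k y) * sinh y)
              + Im k * (cos (gamma_re k y) * cosh y)))%R
      with (Re k * sinh y * - (Im k * (sin (gamma_re k y) * cosh y))
              + Im k * Im k * (cos (gamma_re k y) * (cosh y * cosh y)))%R by ring.
    rewrite e.
    assert (m1 := Rmult_lt_0_compat _ _ hk hk); assert (m2 := Rmult_lt_0_compat _ _ q q).
    assert (m3 := Rmult_lt_0_compat _ _ m1 (Rmult_lt_0_compat _ _ c m2)).
    assert (0 <= cos (gamma_re k y) * ((Re k * sinh y) * (Re k * sinh y))).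
      apply Rmult_le_pos; [lra | apply Rle_0_sqr].
    nra.
  exists (Re (k * Csin (gamma_re k y, y))).
  assert (r : k * Csin (gamma_re k y, y) = Re (k * Csin (gamma_re k y, y))).
    apply C_eq; [reflexivity|]; rewrite Im_k_Csin, e; simpl; ring.
  rewrite <- r, sh; unfold Csin; simpl.
  assert (s := sin2_cos2 (gamma_re k y)); unfold Rsqr in s.
  assert (d : (cosh y * cosh y - sinh y * sinh y = 1)%R).
    unfold cosh, sinh; assert (u : (exp y * exp (- y) = 1)%R)
      by (rewrite <- exp_plus, Rplus_opp_r; apply exp_0). nra.
  set (g := gamma_re k y) in *.
  set (u := ((sin g * cosh y)%R, (cos g * sinh y)%R) : C).
  set (v := ((cos g * cosh y)%R, (- sin g * sinh y)%R) : C).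
  replace (k * k - k * u * (k * u)) with (k * k * (1 - u * u)) by ring.
  replace (k * v * (k * v)) with (k * k * (v * v)) by ring.
  f_equal; apply C_eq; simpl; [|ring].
  assert (cc : (cosh y * cosh y = 1 + sinh y * sinh y)%R) by lra.
  assert (c2 : (cos g * cos g = 1 - sin g * sin g)%R) by lra.
  ring [cc c2].
unfold Csin; simpl; rewrite sin_plus, cos_plus, sin_minus, cos_minus, sin_PI2, cos_PI2.
apply C_eq; simpl; ring.
Qed.

(** A path avoiding both cuts within its half-plane cannot cross the translates of
    Gamma: one of them lies over the avoided cut, the other over the opposite open
    half-plane. *)
Lemma M_strip k alpha : 0 < Im k -> M k alpha ->
  - (PI / 2) < Re alpha - gamma_re k (Im alpha) < PI / 2.
Proof.
intros hk hM; assert (p := PI_RGT_0).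
assert (ex : exists X, (X = H_plus k \/ X = H_minus k) /\ arcsin_image k X alpha).
  destruct hM as [h|h]; [exists (H_plus k) | exists (H_minus k)]; split; auto.
destruct ex as [X [hX [a [ha [a0 [a1 h]]]]]]; rewrite <- a1.
apply (confined_along (fun t => Re (a t) - gamma_re k (Im (a t)))%R (PI / 2)); try lra.
- intros t ht; apply (continuous_minus (V := R_NormedModule)).
    apply continuous_Re_comp, ha, ht.
  apply (continuous_comp (fun t => Im (a t)) (gamma_re k)).
    apply continuous_Im_comp, ha, ht.
  apply continuous_gamma_re.
- rewrite a0; unfold gamma_re; simpl; rewrite sinh_0; unfold Rdiv.
  rewrite Rmult_0_l, Rmult_0_r, atan_0; ring.
- intros t ht; assert (ht' := h t ht).
  destruct (a t) as [x y]; simpl.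
  destruct (h_plus_shore k y hk) as [h1 h2].
  split; intros e.
    replace x with (gamma_re k y + PI / 2)%R in ht' by lra.
    destruct hX; subst X; destruct ht' as [u v].
      contradiction.
    destruct h1; lra.
  replace x with (gamma_re k y - PI / 2)%R in ht' by lra.
  rewrite h2 in ht'.
  assert (r : k * - Csin (gamma_re k y + PI / 2, y)%R = - (k * Csin (gamma_re k y + PI / 2, y)%R))
    by ring.
  rewrite r in ht'.
  destruct hX; subst X; destruct ht' as [u v].
    destruct h1; rewrite im_opp in u; lra.
  elim v; unfold h_minus.
  replace (- - (k * Csin (gamma_re k y + PI / 2, y)%R)) with (k * Csin (gamma_re k y + PI / 2, y)%R)
    by ring.
  assumption.
Qed.
Lemma Re_PI_minus a : Re (PI - a) = (PI - Re a)%R.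
Proof. unfold Re; simpl; ring. Qed.

Lemma Im_PI_minus a : Im (PI - a) = (- Im a)%R.
Proof. unfold Im; simpl; ring. Qed.

(** By oddness of [gamma_re], the reflection [alpha |-> PI - alpha] maps the strip
    around Gamma to its neighbour on the right. *)
Lemma M_closed_flip_strip k e alpha : 0 < Im k -> M_closed k (flip e alpha) ->
  (- (PI / 2) <= Re alpha - gamma_re k (Im alpha) <= 3 * PI / 2)%R.
Proof.
intros hk h; assert (p := PI_RGT_0).
assert (b : - (PI / 2) <= Re (flip e alpha) - gamma_re k (Im (flip e alpha)) <= PI / 2).
  destruct h as [h|[h|h]].
  - assert (b := M_strip k _ hk h); lra.
  - apply Gamma_alpha_re in h; [|assumption].
    replace (flip e alpha - PI / 2) with (flip e alpha - RtoC (PI / 2)) in h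
      by (rewrite RtoC_div by lra; reflexivity).
    unfold Cminus in h; rewrite re_plus in h; simpl in h.
    rewrite Ropp_0, Rplus_0_r in h; unfold Re, Im in *; lra.
  - apply Gamma_alpha_re in h; [|assumption].
    replace (flip e alpha + PI / 2) with (flip e alpha + RtoC (PI / 2)) in h
      by (rewrite RtoC_div by lra; reflexivity).
    rewrite re_plus in h; simpl in h.
    rewrite Rplus_0_r in h; unfold Re, Im in *; lra.
destruct e; unfold flip in b; [|lra].
rewrite Re_PI_minus, Im_PI_minus, gamma_re_opp in b; lra.
Qed.

Lemma M_flip_strip k e alpha : 0 < Im k -> M k (flip e alpha) ->
  (- (PI / 2) < Re alpha - gamma_re k (Im alpha) < 3 * PI / 2)%R.
Proof.
intros hk h; assert (p := PI_RGT_0); apply M_strip in h; [|assumption].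
destruct e; unfold flip in h; [|lra].
rewrite Re_PI_minus, Im_PI_minus, gamma_re_opp in h; lra.
Qed.

Lemma m_minus_re k alpha : 0 < Im k -> m_minus k alpha ->
  Re alpha = (gamma_re k (Im alpha) - PI / 2)%R.
Proof.
intros hk h; apply Gamma_alpha_re in h; [|assumption].
replace (alpha + PI / 2) with (alpha + RtoC (PI / 2)) in h
  by (rewrite RtoC_div by lra; reflexivity).
rewrite re_plus in h; simpl in h.
rewrite Rplus_0_r in h; unfold Re, Im in *; lra.
Qed.

(** The values taken by [a1 + a2] and [a1 - a2 + PI]: one step of the stencil
    equation on either side of the strip covers them. *)
Definition wide_domain (b : C) : Prop := T_domain b /\ - 2 * PI < Re b < 4 * PI.
Definition wide_interior (b : C) : Prop :=
  (- PI < Re b < 3 * PI \/ Im b <> 0%R) /\ - 2 * PI < Re b < 4 * PI.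

(** When [a1 + a2] is real the imaginary parts are opposite, so the contributions
    of [gamma_re] cancel and [a1 + a2] stays in the straight strip; the difference
    is similar, with equal imaginary parts. *)
Lemma Omega_all_closed_sum k a1 a2 : 0 < Im k -> Omega_all_closed k (a1, a2) ->
  wide_domain (a1 + a2) /\ wide_domain (a1 - a2 + PI).
Proof.
intros hk [e1 [e2 [h1 h2]]]; simpl in h1, h2.
apply M_closed_flip_strip in h1; [|assumption].
apply M_closed_flip_strip in h2; [|assumption].
assert (g1 := gamma_re_bound k (Im a1)); assert (g2 := gamma_re_bound k (Im a2)).
unfold wide_domain, T_domain, strip.
replace (Re (a1 + a2)) with (Re a1 + Re a2)%R by reflexivity.
replace (Re (a1 - a2 + PI)) with (Re a1 - Re a2 + PI)%R by reflexivity.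
replace (Im (a1 + a2)) with (Im a1 + Im a2)%R by reflexivity.
replace (Im (a1 - a2 + PI)) with (Im a1 - Im a2)%R by (unfold Im; simpl; ring).
split; (split; [|lra]).
  destruct (Req_dec (Im a1 + Im a2) 0) as [e|n]; [left | right; assumption].
  replace (Im a2) with (- Im a1)%R in * by lra; rewrite gamma_re_opp in *; lra.
destruct (Req_dec (Im a1 - Im a2) 0) as [e|n]; [left | right; assumption].
replace (Im a2) with (Im a1)%R in * by lra; lra.
Qed.

Lemma Omega_all_sum k a1 a2 : 0 < Im k -> Omega_all k (a1, a2) ->
  wide_interior (a1 + a2) /\ wide_interior (a1 - a2 + PI).
Proof.
intros hk [e1 [e2 [h1 h2]]]; simpl in h1, h2.
apply M_flip_strip in h1; [|assumption].
apply M_flip_strip in h2; [|assumption].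
assert (g1 := gamma_re_bound k (Im a1)); assert (g2 := gamma_re_bound k (Im a2)).
unfold wide_interior.
replace (Re (a1 + a2)) with (Re a1 + Re a2)%R by reflexivity.
replace (Re (a1 - a2 + PI)) with (Re a1 - Re a2 + PI)%R by reflexivity.
replace (Im (a1 + a2)) with (Im a1 + Im a2)%R by reflexivity.
replace (Im (a1 - a2 + PI)) with (Im a1 - Im a2)%R by (unfold Im; simpl; ring).
split; (split; [|lra]).
  destruct (Req_dec (Im a1 + Im a2) 0) as [e|n]; [left | right; assumption].
  replace (Im a2) with (- Im a1)%R in * by lra; rewrite gamma_re_opp in *; lra.
destruct (Req_dec (Im a1 - Im a2) 0) as [e|n]; [left | right; assumption].
replace (Im a2) with (Im a1)%R in * by lra; lra.
Qed.
(** * Complex differentiability and gluing *)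

(** Complex differentiability through a slope function continuous at the point:
    products, quotients and gluing reduce to algebra and continuity of slopes. *)
Definition C_differentiable (f : C -> C) (z : C) : Prop :=
  exists phi : C -> C, continuous phi z /\
    locally z (fun w => f w = f z + phi w * (w - z)).

Lemma C_differentiable_continuous f z : C_differentiable f z -> continuous f z.
Proof.
intros [phi [hc hl]].
apply continuous_ext_loc with (fun w => f z + phi w * (w - z)).
  revert hl; apply filter_imp; auto.
apply continuous_Cplus; [apply continuous_const|].
apply continuous_Cmult; [assumption|].
apply continuous_Cminus; [apply continuous_id | apply continuous_const].
Qed.

Lemma C_differentiable_ext_loc f g z :
  locally z (fun w => f w = g w) -> C_differentiable f z -> C_differentiable g z.
Proof.
intros e [phi [hc hl]]; exists phi; split; [assumption|].
assert (ez := locally_singleton _ _ e); simpl in ez.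
assert (n := filter_and _ _ e hl); revert n; apply filter_imp.
intros w [<- h]; rewrite <- ez; assumption.
Qed.

Lemma C_differentiable_const c z : C_differentiable (fun _ => c) z.
Proof.
exists (fun _ => 0); split; [apply continuous_const|].
apply filter_forall; intros w; ring.
Qed.

Lemma C_differentiable_mult f g z :
  C_differentiable f z -> C_differentiable g z -> C_differentiable (fun w => f w * g w) z.
Proof.
intros hf hg; assert (hgc := C_differentiable_continuous _ _ hg).
destruct hf as [p [hp lp]]; destruct hg as [q [hq lq]].
exists (fun w => p w * g w + f z * q w); split.
  apply continuous_Cplus; apply continuous_Cmult; auto using continuous_const.
assert (n := filter_and _ _ lp lq); revert n; apply filter_imp.
intros w [e1 e2]; rewrite e1, e2; ring.
Qed.

Lemma C_differentiable_plus f g z :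
  C_differentiable f z -> C_differentiable g z -> C_differentiable (fun w => f w + g w) z.
Proof.
intros [p [hp lp]] [q [hq lq]].
exists (fun w => p w + q w); split.
  now apply continuous_Cplus.
assert (n := filter_and _ _ lp lq); revert n; apply filter_imp.
intros w [e1 e2]; rewrite e1, e2; ring.
Qed.

Lemma continuous_locally_nonzero (f : C -> C) z :
  continuous f z -> f z <> 0 -> locally z (fun w => f w <> 0).
Proof.
intros hf nz; assert (p := proj1 (Cmod_gt_0 _) nz).
assert (n := continuous_Cmod _ _ hf (fun r => 0 < r) (open_gt 0 _ p)).
unfold filtermap in n; revert n; apply filter_imp.
intros w; apply Cmod_gt_0.
Qed.

Lemma C_differentiable_div f g z :
  C_differentiable f z -> C_differentiable g z -> g z <> 0 ->
  C_differentiable (fun w => f w / g w) z.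
Proof.
intros hf hg nz; apply C_differentiable_mult; [assumption|].
assert (hgc := C_differentiable_continuous _ _ hg).
assert (ln := continuous_locally_nonzero _ _ hgc nz).
destruct hg as [q [hq lq]].
exists (fun w => - q w / (g w * g z)); split.
  apply continuous_Cdiv; [now apply continuous_Copp | | now apply Cmult_neq_0].
  apply continuous_Cmult; [assumption | apply continuous_const].
assert (n := filter_and _ _ lq ln); revert n; apply filter_imp.
intros w [e nw]; replace (q w) with (q w * 1) by ring.
destruct (Ceq_dec (w - z) 0) as [ez|nwz].
  replace w with z by (replace w with (w - z + z) by ring; rewrite ez; ring).
  field; assumption.
replace (q w) with ((g w - g z) / (w - z)) by (rewrite e; field; assumption).
field; auto.
Qed.

Lemma C_differentiable_shift f (c z : C) :
  C_differentiable f (z + c) -> C_differentiable (fun w => f (w + c)) z.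
Proof.
intros [p [hp lp]].
assert (hs : continuous (fun w : C => w + c) z).
  apply continuous_Cplus; [apply continuous_id | apply continuous_const].
exists (fun w => p (w + c)); split.
  now apply (continuous_comp (fun w : C => w + c) p).
assert (n := hs _ lp); unfold filtermap in n; revert n; apply filter_imp.
intros w e; rewrite e; ring.
Qed.

(** [r w - r z = (f w - f z) / (r w + r z)]. *)
Lemma C_differentiable_sqrt r f z :
  locally z (fun w => r w * r w = f w) -> continuous r z -> r z <> 0 ->
  C_differentiable f z -> C_differentiable r z.
Proof.
intros sq hc nz [p [hp lp]].
assert (nz2 : r z + r z <> 0).
  replace (r z + r z) with (2 * r z) by ring.
  apply Cmult_neq_0; [|assumption].
  intros h; apply (f_equal Re) in h; simpl in h; lra.
exists (fun w => p w / (r w + r z)); split.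
  apply continuous_Cdiv; try assumption.
  apply continuous_Cplus; [assumption | apply continuous_const].
assert (ln := continuous_locally_nonzero (fun w => r w + r z) z).
assert (sz := locally_singleton _ _ sq); simpl in sz.
assert (n := filter_and _ _ (filter_and _ _ sq lp) (ln (continuous_Cplus _ _ _ hc (continuous_const _ _)) nz2)).
revert n; apply filter_imp; intros w [[e1 e2] n].
replace (p w / (r w + r z) * (w - z)) with ((f w - f z) / (r w + r z))
  by (rewrite e2; field; assumption).
rewrite <- e1, <- sz; field; assumption.
Qed.

(** On the line [Re z = c] the two slopes agree: both are limits of the same
    quotients taken along the line.  So the pieces fit together to first order, and
    that is all complex differentiability asks for. *)
Lemma C_differentiable_glue (f g : C -> C) (c : R) z :
  (c <= Re z -> C_differentiable f z) -> (Re z <= c -> C_differentiable g z) ->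
  (Re z = c -> locally z (fun w => Re w = c -> f w = g w)) ->
  C_differentiable (fun w => if Rle_dec c (Re w) then f w else g w) z.
Proof.
intros hf hg e.
destruct (Rtotal_order (Re z) c) as [l|[l|l]].
- apply C_differentiable_ext_loc with g; [|apply hg; lra].
  assert (n := continuous_Re_comp _ _ (continuous_id z) (fun x => x < c) (open_lt c _ l)).
  unfold filtermap in n; revert n; apply filter_imp.
  intros y; destruct (Rle_dec c (Re y)); auto; lra.
- destruct (hf (Req_le _ _ (eq_sym l))) as [p [hp lp]].
  destruct (hg (Req_le _ _ l)) as [q [hq lq]].
  assert (e' := e l); assert (ez := locally_singleton _ _ e' l); simpl in ez.
  (* Evaluate both slopes at nearby points of the line, where f and g agree. *)
  assert (pq : p z = q z).
    assert (hd : continuous (fun w => Cmod (p w - q w)) z)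
      by now apply continuous_Cmod, continuous_Cminus.
    destruct (Ceq_dec (p z - q z) 0) as [d|d].
      replace (p z) with (p z - q z + q z) by ring; rewrite d; ring.
    assert (m := continuous_locally_nonzero _ _ (continuous_Cminus _ _ _ hp hq) d).
    destruct (filter_and _ _ m (filter_and _ _ e' (filter_and _ _ lp lq))) as [eps he].
    set (w := (Re z, Im z + eps / 2)%R : C).
    assert (b : ball z eps w).
      destruct z as [x y]; assert (pe := cond_pos eps); split; simpl.
        apply ball_center.
      unfold ball; simpl; unfold AbsRing_ball, abs, minus, plus, opp; simpl.
      rewrite Rabs_right; lra.
    destruct (he w b) as [m1 [m2 [m3 m4]]]; elim m1.
    assert (m5 : f w = g w) by (apply m2; exact l).
    assert (nz : w - z <> 0).
      intros h; apply (f_equal Im) in h; assert (pe := cond_pos eps).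
      unfold w, Im in h; simpl in h; lra.
    replace (p w) with ((f w - f z) / (w - z)) by (rewrite m3; field; assumption).
    replace (q w) with ((g w - g z) / (w - z)) by (rewrite m4; field; assumption).
    rewrite m5, ez; ring.
  exists (fun w => if Rle_dec c (Re w) then p w else q w); split.
    apply continuous_if; auto.
    apply continuous_Re_comp, continuous_id.
  assert (n := filter_and _ _ lp lq); revert n; apply filter_imp.
  intros w [e1 e2]; destruct (Rle_dec c (Re z)); [|lra].
  destruct (Rle_dec c (Re w)); [assumption|]. rewrite ez; assumption.
- apply C_differentiable_ext_loc with f; [|apply hf; lra].
  assert (n := continuous_Re_comp _ _ (continuous_id z) (fun x => c < x) (open_gt c _ l)).
  unfold filtermap in n; revert n; apply filter_imp.
  intros y; destruct (Rle_dec c (Re y)); auto; lra.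
Qed.
Lemma ex_filterdiff_C_differentiable (f : C -> C) (z : C) :
  ex_filterdiff (U := C_NormedModule) (V := C_NormedModule) f (locally z) ->
  C_differentiable f z.
Proof.
intros [l [hl hd]]; specialize (hd z (fun P HP => HP)).
assert (lin : forall h : C, l h = h * l (RtoC 1)).
  intros h; change (h * l (RtoC 1)) with (scal h (l (RtoC 1)) : C_NormedModule).
  rewrite <- (linear_scal l hl); f_equal.
  change (h = h * 1); ring.
exists (fun w => if Ceq_dec w z then l (RtoC 1) else (f w - f z) / (w - z)); split.
  apply (filterlim_locally_ball_norm (U := C_NormedModule)).
  intros eps; destruct (Ceq_dec z z) as [_|n]; [|now elim n].
  assert (e2 : 0 < eps / 2) by (assert (p := cond_pos eps); lra).
  assert (n := hd (mkposreal _ e2)); revert n; apply filter_imp; simpl.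
  intros w hw; unfold ball_norm; simpl.
  destruct (Ceq_dec w z) as [->|nw].
    change (Cmod (l (RtoC 1) - l (RtoC 1)) < eps); replace (l (RtoC 1) - l (RtoC 1)) with (RtoC 0) by ring.
    rewrite Cmod_0; apply cond_pos.
  change (Cmod (f w - f z - l (w - z)) <= eps / 2 * Cmod (w - z)) in hw.
  change (Cmod ((f w - f z) / (w - z) - l (RtoC 1)) < eps).
  assert (nz : w - z <> 0).
    intros e; apply nw; replace w with (w - z + z) by ring; rewrite e; ring.
  assert (pz := proj1 (Cmod_gt_0 _) nz).
  rewrite lin in hw.
  replace ((f w - f z) / (w - z) - l (RtoC 1)) with ((f w - f z - (w - z) * l (RtoC 1)) / (w - z))
    by (field; assumption).
  rewrite Cmod_div by assumption.
  apply Rmult_lt_reg_r with (Cmod (w - z)); [assumption|].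
  unfold Rdiv; rewrite Rmult_assoc, Rinv_l by lra.
  assert (p := cond_pos eps); nra.
apply filter_forall; intros w; destruct (Ceq_dec w z) as [->|n].
  ring.
field; intros e; apply n; replace w with (w - z + z) by ring; rewrite e; ring.
Qed.

(** The two-variable counterpart of [C_differentiable]: partial slopes continuous
    at the point give a Frechet derivative. *)
Lemma ex_filterdiff_of_slopes (F p q : C * C -> C) (x : C * C) :
  continuous p x -> continuous q x ->
  locally x (fun y => F y = F x + p y * (fst y - fst x) + q y * (snd y - snd x)) ->
  ex_filterdiff (U := prod_NormedModule C_AbsRing C_NormedModule C_NormedModule)
    (V := C_NormedModule) F (locally x).
Proof.
intros hp hq hl.
exists (fun h : C * C => p x * fst h + q x * snd h); split.
  split.
  - intros u v; unfold plus; simpl; unfold plus; simpl; ring.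
  - intros k u; unfold scal; simpl; unfold scal; simpl; unfold mult; simpl; ring.
  - exists (Cmod (p x) + Cmod (q x) + 1)%R; split.
      assert (a := Cmod_ge_0 (p x)); assert (b := Cmod_ge_0 (q x)); lra.
    intros [h1 h2].
    change (Cmod (p x * h1 + q x * h2) <= (Cmod (p x) + Cmod (q x) + 1)
       * sqrt (Cmod h1 ^ 2 + Cmod h2 ^ 2)).
    assert (a1 := sqrt_plus_sqr (Cmod h1) (Cmod h2)).
    rewrite !Rabs_right in a1 by apply Rle_ge, Cmod_ge_0.
    destruct a1 as [a1 _]; assert (m1 := Rmax_l (Cmod h1) (Cmod h2)).
    assert (m2 := Rmax_r (Cmod h1) (Cmod h2)).
    eapply Rle_trans; [apply Cmod_triangle|]; rewrite !Cmod_mult.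
    set (S := sqrt _) in *.
    assert (a := Cmod_ge_0 (p x)); assert (b := Cmod_ge_0 (q x)).
    assert (c := Cmod_ge_0 h1); assert (d := Cmod_ge_0 h2).
    assert (Cmod (p x) * Cmod h1 <= Cmod (p x) * S) by (apply Rmult_le_compat_l; lra).
    assert (Cmod (q x) * Cmod h2 <= Cmod (q x) * S) by (apply Rmult_le_compat_l; lra).
    nra.
intros x' hx; assert (ex := is_filter_lim_locally_unique _ _ hx); subst x'.
intros eps.
assert (e2 : 0 < eps / 2) by (assert (h := cond_pos eps); lra).
assert (np := proj1 (filterlim_locally_ball_norm (U := C_NormedModule) p (p x)) hp (mkposreal _ e2)).
assert (nq := proj1 (filterlim_locally_ball_norm (U := C_NormedModule) q (q x)) hq (mkposreal _ e2)).
assert (n := filter_and _ _ (filter_and _ _ np nq) hl); revert n; apply filter_imp.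
intros [y1 y2] [[b1 b2] e]; destruct x as [x1 x2]; simpl in e.
change (Cmod (p (y1, y2) - p (x1, x2)) < eps / 2) in b1.
change (Cmod (q (y1, y2) - q (x1, x2)) < eps / 2) in b2.
change (Cmod (F (y1, y2) - F (x1, x2) - (p (x1, x2) * (y1 - x1) + q (x1, x2) * (y2 - x2)))
  <= eps * sqrt (Cmod (y1 - x1) ^ 2 + Cmod (y2 - x2) ^ 2)).
assert (e' : F (y1, y2) = F (x1, x2) + p (y1, y2) * (y1 - x1) + q (y1, y2) * (y2 - x2))
  by exact e.
rewrite e'.
replace (F (x1, x2) + p (y1, y2) * (y1 - x1) + q (y1, y2) * (y2 - x2) - F (x1, x2)
   - (p (x1, x2) * (y1 - x1) + q (x1, x2) * (y2 - x2)))
 with ((p (y1, y2) - p (x1, x2)) * (y1 - x1) + (q (y1, y2) - q (x1, x2)) * (y2 - x2)) by ring.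
assert (a1 := sqrt_plus_sqr (Cmod (y1 - x1)) (Cmod (y2 - x2))).
rewrite !Rabs_right in a1 by apply Rle_ge, Cmod_ge_0.
destruct a1 as [a1 _]; assert (m1 := Rmax_l (Cmod (y1 - x1)) (Cmod (y2 - x2))).
assert (m2 := Rmax_r (Cmod (y1 - x1)) (Cmod (y2 - x2))).
eapply Rle_trans; [apply Cmod_triangle|]; rewrite !Cmod_mult.
set (S := sqrt _) in *.
assert (c := Cmod_ge_0 (y1 - x1)); assert (d := Cmod_ge_0 (y2 - x2)).
assert (Cmod (p (y1, y2) - p (x1, x2)) * Cmod (y1 - x1) <= eps / 2 * S).
  apply Rmult_le_compat; try lra; apply Cmod_ge_0.
assert (Cmod (q (y1, y2) - q (x1, x2)) * Cmod (y2 - x2) <= eps / 2 * S).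
  apply Rmult_le_compat; try lra; apply Cmod_ge_0.
lra.
Qed.

Lemma ex_filterdiff_product (f g : C -> C) (x : C * C) :
  C_differentiable f (fst x + snd x) -> C_differentiable g (fst x - snd x + PI) ->
  ex_filterdiff (U := prod_NormedModule C_AbsRing C_NormedModule C_NormedModule)
    (V := C_NormedModule)
    (fun y : C * C => f (fst y + snd y) * g (fst y - snd y + PI)) (locally x).
Proof.
intros hf hg.
assert (c1 : continuous (fun y : C * C => fst y + snd y) x)
  by (apply continuous_Cplus; [apply continuous_fst | apply continuous_snd]).
assert (c2 : continuous (fun y : C * C => fst y - snd y + PI) x).
  apply continuous_Cplus; [|apply continuous_const].
  apply continuous_Cminus; [apply continuous_fst | apply continuous_snd].
assert (cg := continuous_comp _ g _ c2 (C_differentiable_continuous _ _ hg)).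
destruct hf as [p [hp lp]]; destruct hg as [q [hq lq]].
assert (cp := continuous_comp _ p _ c1 hp); assert (cq := continuous_comp _ q _ c2 hq).
pose (u := fun y : C * C => p (fst y + snd y) * g (fst y - snd y + PI)).
pose (v := fun y : C * C => f (fst x + snd x) * q (fst y - snd y + PI)).
assert (cu : continuous u x) by now apply continuous_Cmult.
assert (cv : continuous v x) by (apply continuous_Cmult; [apply continuous_const | assumption]).
apply ex_filterdiff_of_slopes with (fun y => u y + v y) (fun y => u y - v y).
- now apply continuous_Cplus.
- now apply continuous_Cminus.
- assert (n1 := c1 _ lp); assert (n2 := c2 _ lq); unfold filtermap in n1, n2.
  assert (n := filter_and _ _ n1 n2); revert n.
  apply filter_imp; intros [y1 y2] [e1 e2]; unfold u, v; destruct x as [x1 x2].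
  simpl in *; rewrite e1, e2; ring.
Qed.
(** * Triplets of sheets and the stencil relation *)

Lemma root_along_of (q : C -> C) (c : R -> C) (eps : C) :
  path c -> eps * eps = 1 ->
  (forall t, 0 <= t <= 1 -> continuous q (c t) /\ q (c t) * q (c t) = branch_poly (c t)
     /\ branch_poly (c t) <> 0) ->
  root_along (fun t => branch_poly (c t)) (fun t => eps * q (c t)).
Proof.
intros hc he hq t ht; destruct (hq t ht) as [h1 [h2 h3]]; split; [|split].
- apply continuous_Cmult; [apply continuous_const|].
  apply (continuous_comp c q); [apply hc, ht | assumption].
- intros e; apply h3; rewrite <- h2.
  replace (q (c t) * q (c t)) with (eps * eps * (q (c t) * q (c t))) by (rewrite he; ring).
  replace (eps * eps * (q (c t) * q (c t))) with (eps * q (c t) * (eps * q (c t))) by ring.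
  rewrite e; ring.
- replace (eps * q (c t) * (eps * q (c t))) with (eps * eps * (q (c t) * q (c t))) by ring.
  rewrite he, h2; ring.
Qed.

Lemma continuous_arc (x0 l h : R) :
  path (fun t => ((x0 + l * t)%R, (h * (t * (1 - t)))%R) : C).
Proof.
intros t _; apply continuous_C; simpl; apply (ex_derive_continuous (V := R_NormedModule));
  auto_derive; auto.
Qed.

(** From pi, the points -pi and 3pi are reached along parabolic arcs above and below
    the branch points.  The upper arc carries [eps * upper_root]; the lower one
    carries [- eps * Cconj upper_root], which is the same at pi, where [upper_root]
    is imaginary, and the opposite at 3pi, where it is real. *)
Lemma reference_triplet_roots (eps : C) : eps * eps = 1 ->
  reference_triplet (eps * outer_root (- PI)) (eps * inner_root PI) (- (eps * outer_root (3 * PI))).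
Proof.
intros he; assert (p := PI_RGT_0).
pose (u := fun t : R => ((PI + -2 * PI * t)%R, (1 * (t * (1 - t)))%R) : C).
pose (v := fun t : R => ((PI + 2 * PI * t)%R, (-1 * (t * (1 - t)))%R) : C).
assert (hu : path u) by apply continuous_arc.
assert (hv : path v) by apply continuous_arc.
assert (hI : forall t, 0 <= t <= 1 -> 0 <= t * (1 - t)) by (intros; nra).
assert (hz : forall t, (t * (1 - t) = 0 -> t = 0 \/ t = 1)%R).
  intros t h; apply Rmult_integral in h; destruct h; lra.
exists u, v, (fun t => eps * upper_root (u t)), (fun t => - eps * Cconj (upper_root (v t))).
split; [assumption|]; split; [assumption|]; split; [|split; [|split]].
- apply root_along_of; try assumption; intros t ht; split; [|split].
  + apply continuous_upper_root.
  + apply upper_root_sqr; simpl; specialize (hI t ht); lra.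
  + intros e; destruct (branch_poly_zero _ e) as [e1 e2]; simpl in e1, e2.
    destruct (hz t) as [->| ->]; destruct e2; lra.
- apply (root_along_of (fun b => Cconj (upper_root b))); try assumption.
    rewrite <- he; ring.
  intros t ht; split; [|split].
  + apply continuous_Cconj, continuous_upper_root.
  + apply lower_root_sqr; simpl; specialize (hI t ht); lra.
  + intros e; destruct (branch_poly_zero _ e) as [e1 e2]; simpl in e1, e2.
    destruct (hz t) as [->| ->]; destruct e2; lra.
- intros t ht; specialize (hI t ht).
  split; (split; [left; unfold strip; simpl; nra | simpl; lra]).
- assert (u0 : u 0%R = PI) by (apply C_eq; simpl; ring).
  assert (u1 : u 1%R = - PI) by (apply C_eq; simpl; ring).
  assert (v0 : v 0%R = PI) by (apply C_eq; simpl; ring).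
  assert (v1 : v 1%R = 3 * PI) by (apply C_eq; simpl; ring).
  rewrite u0, u1, v0, v1, inner_root_PI, outer_root_mPI, outer_root_3PI, conj_upper_root_PI.
  repeat split; ring.
Qed.

(** The points [b] from which the whole triplet avoids the branch points while
    staying in [T_domain]. *)
Definition triplet_start (b : C) : Prop := b = - PI \/ Im b <> 0%R.

Lemma triplet_start_domains b : triplet_start b ->
  off_segment b /\ off_rays (b + 2 * PI) /\ off_segment (b + 4 * PI).
Proof.
assert (p := PI_RGT_0); unfold off_segment, off_rays.
intros [->|h].
  split; [|split]; right; C_lra.
assert (e2 : Im (b + 2 * PI) = Im b) by (unfold Im; simpl; ring).
assert (e4 : Im (b + 4 * PI) = Im b) by (unfold Im; simpl; ring).
rewrite e2, e4; auto.
Qed.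

(** The segment from -pi to [b] stays in [triplet_start], where the three roots are
    continuous. *)
Lemma continued_triplet_roots (b eps : C) : triplet_start b -> eps * eps = 1 ->
  continued_triplet b (eps * outer_root b) (eps * inner_root (b + 2 * PI))
    (- (eps * outer_root (b + 4 * PI))).
Proof.
intros hb he; assert (p := PI_RGT_0).
pose (c := fun t : R => - PI + t * (b + PI)).
assert (hc : forall d : C, path (fun t => c t + d)).
  intros d t _; apply continuous_Cplus; [|apply continuous_const].
  apply continuous_Cplus; [apply continuous_const|].
  apply continuous_Cmult; [|apply continuous_const].
  apply continuous_C; simpl; [apply continuous_id | apply continuous_const].
assert (hc0 : path c).
  intros t ht; apply continuous_ext with (fun t => c t + 0); [intros; apply Cplus_0_r | now apply hc].
assert (c0 : c 0%R = - PI) by (unfold c; ring).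
assert (c1 : c 1%R = b) by (unfold c; ring).
assert (on : forall t, 0 <= t <= 1 -> triplet_start (c t)).
  intros t ht; destruct hb as [->|n].
    left; unfold c; ring.
  destruct (Req_dec t 0) as [->|nt]; [left; exact c0|].
  right; replace (Im (c t)) with (t * Im b)%R by (unfold c, Im; simpl; ring).
  now apply Rmult_integral_contrapositive.
exists c, (fun t => eps * outer_root (c t)), (fun t => eps * inner_root (c t + 2 * PI)),
  (fun t => - eps * outer_root (c t + 4 * PI)).
split; [assumption|]; split; [assumption|]; split; [assumption|].
split; [|split; [|split; [|split; [|split; [|split]]]]].
- intros t ht; destruct (on t ht) as [->|n].
    unfold T_domain, strip; split; [|split]; left; C_lra.
  unfold T_domain; split; [|split]; right.
    assumption.
  replace (Im (c t + 2 * PI)) with (Im (c t)) by (unfold Im; simpl; ring); assumption.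
  replace (Im (c t + 4 * PI)) with (Im (c t)) by (unfold Im; simpl; ring); assumption.
- apply root_along_of; try assumption; intros t ht; destruct (triplet_start_domains _ (on t ht)) as [h _].
  split; [now apply continuous_outer_root|]; split; [apply outer_root_sqr | now apply off_segment_neq].
- apply (root_along_of inner_root (fun t => c t + 2 * PI)); auto.
  intros t ht; destruct (triplet_start_domains _ (on t ht)) as [_ [h _]].
  split; [now apply continuous_inner_root|]; split; [apply inner_root_sqr | now apply off_rays_neq].
- apply (root_along_of outer_root (fun t => c t + 4 * PI)); auto.
    rewrite <- he; ring.
  intros t ht; destruct (triplet_start_domains _ (on t ht)) as [_ [_ h]].
  split; [now apply continuous_outer_root|]; split; [apply outer_root_sqr | now apply off_segment_neq].
- rewrite c0.
  replace (- PI + 2 * PI) with (RtoC PI) by (apply C_eq; simpl; ring).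
  replace (- PI + 4 * PI) with (3 * PI) by (apply C_eq; simpl; ring).
  replace (- eps * outer_root (3 * PI)) with (- (eps * outer_root (3 * PI))) by ring.
  now apply reference_triplet_roots.
- rewrite c1; reflexivity.
- rewrite c1; split; [reflexivity | ring].
Qed.

Lemma square_root_sign (s q : C) : s * s = q * q -> q <> 0 ->
  exists eps, eps * eps = 1 /\ s = eps * q.
Proof.
intros e n; exists (s / q); split.
  replace (s / q * (s / q)) with (s * s / (q * q)) by (field; assumption).
  rewrite e; field; assumption.
field; assumption.
Qed.

Lemma sheet_sign_outer b s : off_segment b -> s * s = branch_poly b ->
  exists eps, eps * eps = 1 /\ s = eps * outer_root b.
Proof.
intros h e; apply square_root_sign.
  rewrite outer_root_sqr; assumption.
intros z; apply (off_segment_neq b h); rewrite <- outer_root_sqr, z; ring.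
Qed.

Lemma outer_root_neq b : off_segment b -> outer_root b <> 0.
Proof.
intros h z; apply (off_segment_neq b h); rewrite <- outer_root_sqr, z; ring.
Qed.

Lemma stencil_relation lambda T b eps : OneDSt lambda T -> triplet_start b -> eps * eps = 1 ->
  T b (eps * outer_root b) + T (b + 4 * PI) (- (eps * outer_root (b + 4 * PI)))
    = lambda * T (b + 2 * PI) (eps * inner_root (b + 2 * PI)).
Proof.
intros hT hb he.
assert (h := OneDSt2 _ _ hT _ _ _ _ (continued_triplet_roots b eps hb he)).
now apply Cminus_eq_0.
Qed.
(** * Continuation beyond the strip *)

Lemma locally_nonreal (z : C) : Im z <> 0%R -> locally z (fun w => Im w <> 0%R).
Proof.
intros h; assert (n := continuous_Im_comp _ _ (continuous_id z) _ (open_neq 0%R _ h)).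
exact n.
Qed.

Lemma C_differentiable_root (q : C -> C) (z : C) :
  (forall b, q b * q b = branch_poly b) -> continuous q z -> branch_poly z <> 0 ->
  C_differentiable q z.
Proof.
intros hq hc nz; apply C_differentiable_sqrt with branch_poly; auto.
- apply filter_forall; auto.
- intros e; apply nz; rewrite <- hq, e; ring.
- apply C_differentiable_ext_loc with (fun b => (b + RtoC (PI / 2)) * (b + - RtoC (5 * PI / 2))).
    apply filter_forall; intros b; symmetry; apply branch_polyE.
  assert (id : forall w, C_differentiable (fun b => b) w).
    intros w; exists (fun _ => 1); split; [apply continuous_const|].
    assert (e : forall b : C, b = w + 1 * (b - w)) by (intros; ring).
    apply filter_forall; exact e.
  apply C_differentiable_mult; apply (C_differentiable_shift (fun b => b)), id.
Qed.

(** The stencil relation solved for the regular factor [A] of [T]. *)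
Definition extend_left (lambda : C) (A : C -> C) (b : C) : C :=
  (lambda * (inner_root (b + 2 * PI) * A (b + 2 * PI))
     + outer_root (b + 4 * PI) * A (b + 4 * PI)) / outer_root b.

Definition extend_right (lambda : C) (A : C -> C) (b : C) : C :=
  (outer_root (b + - (4 * PI)) * A (b + - (4 * PI))
     + - lambda * (inner_root (b + - (2 * PI)) * A (b + - (2 * PI)))) / outer_root b.

Definition extend (lambda : C) (A : C -> C) (b : C) : C :=
  if Rle_dec (- PI) (Re b) then
    if Rle_dec (3 * PI) (Re b) then extend_right lambda A b else A b
  else extend_left lambda A b.

Lemma Re_Im_shift (b : C) (r : R) :
  Re (b + RtoC r * PI) = (Re b + r * PI)%R /\ Im (b + RtoC r * PI) = Im b /\
  Re (b + - (RtoC r * PI)) = (Re b - r * PI)%R /\ Im (b + - (RtoC r * PI)) = Im b.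
Proof. unfold Re, Im; simpl; repeat split; ring. Qed.

Ltac shift_simpl := repeat match goal with
  | |- context [Re (?b + RtoC ?r * RtoC PI)] => rewrite (proj1 (Re_Im_shift b r))
  | |- context [Im (?b + RtoC ?r * RtoC PI)] => rewrite (proj1 (proj2 (Re_Im_shift b r)))
  | |- context [Re (?b + - (RtoC ?r * RtoC PI))] => rewrite (proj1 (proj2 (proj2 (Re_Im_shift b r))))
  | |- context [Im (?b + - (RtoC ?r * RtoC PI))] => rewrite (proj2 (proj2 (proj2 (Re_Im_shift b r))))
  end.

Lemma signed_root_sqr eps q b : eps * eps = 1 -> q * q = branch_poly b ->
  eps * q * (eps * q) = branch_poly b.
Proof.
intros e h; replace (eps * q * (eps * q)) with (eps * eps * (q * q)) by ring.
rewrite e, h; ring.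
Qed.

Lemma opp_signed_root_sqr eps q b : eps * eps = 1 -> q * q = branch_poly b ->
  - (eps * q) * - (eps * q) = branch_poly b.
Proof. intros e h; rewrite <- (signed_root_sqr eps q b e h); ring. Qed.

(** On every sheet the same sign [eps] multiplies the three terms of the stencil
    relation, so that the regular factor does not depend on the sheet. *)
Lemma T_extend_left lambda T A b s : OneDSt lambda T ->
  (forall b s, strip b -> s * s = branch_poly b -> T b s = s * A b) ->
  triplet_start b -> - 3 * PI <= Re b <= - PI -> s * s = branch_poly b ->
  T b s = s * extend_left lambda A b.
Proof.
intros hT hA hb hr hs; assert (p := PI_RGT_0).
destruct (triplet_start_domains b hb) as [d0 _].
destruct (sheet_sign_outer b s d0 hs) as [eps [he ->]].
assert (h := stencil_relation _ _ _ _ hT hb he).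
rewrite (hA (b + 4 * PI)) in h;
  [ | unfold strip; shift_simpl; lra | now apply opp_signed_root_sqr, outer_root_sqr ].
rewrite (hA (b + 2 * PI)) in h;
  [ | unfold strip; shift_simpl; lra | now apply signed_root_sqr, inner_root_sqr ].
apply Cminus_eq_0; unfold extend_left.
assert (nz := outer_root_neq b d0).
match type of h with ?l = ?r => assert (h' : l - r = 0) by (rewrite h; ring) end.
rewrite <- h'; field; assumption.
Qed.

Lemma T_extend_right lambda T A b s : OneDSt lambda T ->
  (forall b s, strip b -> s * s = branch_poly b -> T b s = s * A b) ->
  triplet_start (b + - (4 * PI)) -> 3 * PI <= Re b <= 5 * PI -> s * s = branch_poly b ->
  T b s = s * extend_right lambda A b.
Proof.
intros hT hA hb hr hs; assert (p := PI_RGT_0).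
destruct (triplet_start_domains _ hb) as [_ [_ d0]].
replace (b + - (4 * PI) + 4 * PI) with b in d0 by ring.
destruct (sheet_sign_outer b s d0 hs) as [eps [he ->]].
assert (he' : - eps * - eps = 1) by (rewrite <- he; ring).
assert (h := stencil_relation _ _ _ (- eps) hT hb he').
replace (b + - (4 * PI) + 4 * PI) with b in h by ring.
replace (b + - (4 * PI) + 2 * PI) with (b + - (2 * PI)) in h by (apply C_eq; simpl; ring).
replace (- (- eps * outer_root b)) with (eps * outer_root b) in h by ring.
rewrite (hA (b + - (4 * PI))) in h;
  [ | unfold strip; shift_simpl; lra | now apply signed_root_sqr, outer_root_sqr ].
rewrite (hA (b + - (2 * PI))) in h;
  [ | unfold strip; shift_simpl; lra | now apply signed_root_sqr, inner_root_sqr ].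
apply Cminus_eq_0; unfold extend_right.
assert (nz := outer_root_neq b d0).
match type of h with ?l = ?r => assert (h' : l - r = 0) by (rewrite h; ring) end.
rewrite <- h'; field; assumption.
Qed.

Lemma strip_extend_left lambda T A b : OneDSt lambda T ->
  (forall b s, strip b -> s * s = branch_poly b -> T b s = s * A b) ->
  triplet_start b -> Re b = (- PI)%R -> A b = extend_left lambda A b.
Proof.
intros hT hA hb hr; assert (p := PI_RGT_0).
destruct (triplet_start_domains b hb) as [d0 _]; assert (nz := outer_root_neq b d0).
assert (e : outer_root b * A b = outer_root b * extend_left lambda A b).
  rewrite <- (hA b); [ | unfold strip; lra | apply outer_root_sqr ].
  apply (T_extend_left lambda T); try assumption; [lra | apply outer_root_sqr].
replace (A b) with (outer_root b * A b / outer_root b) by (field; assumption).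
rewrite e; field; assumption.
Qed.

Lemma strip_extend_right lambda T A b : OneDSt lambda T ->
  (forall b s, strip b -> s * s = branch_poly b -> T b s = s * A b) ->
  triplet_start (b + - (4 * PI)) -> Re b = (3 * PI)%R -> A b = extend_right lambda A b.
Proof.
intros hT hA hb hr; assert (p := PI_RGT_0).
destruct (triplet_start_domains _ hb) as [_ [_ d0]].
replace (b + - (4 * PI) + 4 * PI) with b in d0 by ring.
assert (nz := outer_root_neq b d0).
assert (e : outer_root b * A b = outer_root b * extend_right lambda A b).
  rewrite <- (hA b); [ | unfold strip; lra | apply outer_root_sqr ].
  apply (T_extend_right lambda T); try assumption; [lra | apply outer_root_sqr].
replace (A b) with (outer_root b * A b / outer_root b) by (field; assumption).
rewrite e; field; assumption.
Qed.

Lemma wide_domain_left b : wide_domain b -> Re b <= - PI -> triplet_start b.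
Proof.
intros [[[h _]|h] _] hr; [|right; assumption].
destruct (Req_dec (Im b) 0) as [e|n]; [left | right; assumption].
apply C_eq; simpl; lra.
Qed.

Lemma wide_domain_right b : wide_domain b -> 3 * PI <= Re b -> triplet_start (b + - (4 * PI)).
Proof.
intros [h _] hr.
destruct (Req_dec (Im b) 0) as [e|n]; [left | right; shift_simpl; assumption].
destruct h as [h|h]; [|contradiction].
unfold strip in h; apply C_eq; shift_simpl; simpl; lra.
Qed.

Lemma wide_interior_domain b : wide_interior b -> wide_domain b.
Proof.
intros [[h|h] r]; split; try assumption; [left; unfold strip; lra | right; assumption].
Qed.

Lemma extend_left_differentiable lambda A b :
  (forall b, strip b -> C_differentiable A b) ->
  triplet_start b -> - 3 * PI <= Re b <= - PI -> C_differentiable (extend_left lambda A) b.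
Proof.
intros dA d hb; assert (p := PI_RGT_0).
destruct (triplet_start_domains _ d) as [d1 [d2 d3]].
apply C_differentiable_div; [ | | now apply outer_root_neq].
  2: apply C_differentiable_root;
       auto using outer_root_sqr, continuous_outer_root, off_segment_neq.
apply C_differentiable_plus.
  apply C_differentiable_mult; [apply C_differentiable_const|].
  apply (C_differentiable_shift (fun w => inner_root w * A w)), C_differentiable_mult.
    apply C_differentiable_root;
      auto using inner_root_sqr, continuous_inner_root, off_rays_neq.
  apply dA; unfold strip; shift_simpl; lra.
apply (C_differentiable_shift (fun w => outer_root w * A w)), C_differentiable_mult.
  apply C_differentiable_root;
    auto using outer_root_sqr, continuous_outer_root, off_segment_neq.
apply dA; unfold strip; shift_simpl; lra.
Qed.

Lemma extend_right_differentiable lambda A b :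
  (forall b, strip b -> C_differentiable A b) ->
  triplet_start (b + - (4 * PI)) -> 3 * PI <= Re b <= 5 * PI ->
  C_differentiable (extend_right lambda A) b.
Proof.
intros dA d hb; assert (p := PI_RGT_0).
destruct (triplet_start_domains _ d) as [d1 [d2 d3]].
replace (b + - (4 * PI) + 4 * PI) with b in d3 by ring.
replace (b + - (4 * PI) + 2 * PI) with (b + - (2 * PI)) in d2 by (apply C_eq; simpl; ring).
apply C_differentiable_div; [ | | now apply outer_root_neq].
  2: apply C_differentiable_root;
       auto using outer_root_sqr, continuous_outer_root, off_segment_neq.
apply C_differentiable_plus.
  apply (C_differentiable_shift (fun w => outer_root w * A w)), C_differentiable_mult.
    apply C_differentiable_root;
      auto using outer_root_sqr, continuous_outer_root, off_segment_neq.
  apply dA; unfold strip; shift_simpl; lra.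
apply C_differentiable_mult; [apply C_differentiable_const|].
apply (C_differentiable_shift (fun w => inner_root w * A w)), C_differentiable_mult.
  apply C_differentiable_root;
    auto using inner_root_sqr, continuous_inner_root, off_rays_neq.
apply dA; unfold strip; shift_simpl; lra.
Qed.

(** [T] keeps the form of [OneDSt1] on the whole range needed.  At -pi and 3pi only
    continuity is claimed: the continuations from the two half-planes match there in
    value, but are cut from each other along the real axis. *)
Lemma OneDSt_extension lambda T : OneDSt lambda T -> exists E : C -> C,
  (forall b s, wide_domain b -> s * s = branch_poly b -> T b s = s * E b) /\
  (forall b, wide_domain b -> continuous E b) /\
  (forall b, wide_interior b -> C_differentiable E b).
Proof.
intros hT; assert (p := PI_RGT_0).
destruct (OneDSt1 _ _ hT) as [A [hol hA]].
assert (dA : forall b, strip b -> C_differentiable A b).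
  intros b hb; apply ex_filterdiff_C_differentiable.
  exact (locally_singleton _ _ (hol b hb)).
assert (dL : forall b, wide_domain b -> Re b <= - PI -> C_differentiable (extend_left lambda A) b).
  intros b hb l; assert (r := proj2 hb).
  apply extend_left_differentiable; [assumption | now apply wide_domain_left | lra].
assert (dR : forall b, wide_domain b -> 3 * PI <= Re b -> C_differentiable (extend_right lambda A) b).
  intros b hb l; assert (r := proj2 hb).
  apply extend_right_differentiable; [assumption | now apply wide_domain_right | lra].
exists (extend lambda A); split; [|split].
- intros b s hb hs; unfold extend; assert (r := proj2 hb).
  destruct Rle_dec as [l|l]; [destruct Rle_dec as [l'|l']|].
  + apply T_extend_right; auto using wide_domain_right; lra.
  + apply hA; [unfold strip; lra | assumption].
  + apply T_extend_left; try assumption; [apply wide_domain_left; [assumption|] |]; lra.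
- intros b hb; apply continuous_if.
  + apply continuous_Re_comp, continuous_id.
  + intros l; apply continuous_if.
    * apply continuous_Re_comp, continuous_id.
    * intros l'; apply C_differentiable_continuous; auto.
    * intros l'; apply C_differentiable_continuous, dA; unfold strip; lra.
    * intros l'; symmetry; apply strip_extend_right with T; auto.
      apply wide_domain_right; [assumption | lra].
  + intros l; apply C_differentiable_continuous; auto.
  + intros l; destruct Rle_dec as [l'|l']; [lra|].
    apply strip_extend_left with T; auto.
    apply wide_domain_left; [assumption | lra].
- intros b hb; assert (hw := wide_interior_domain b hb).
  apply C_differentiable_glue.
  + intros l; apply C_differentiable_glue; auto.
    * intros l'; apply dA; unfold strip; lra.
    * intros l'; assert (n : Im b <> 0%R) by (destruct hb as [[h|h] _]; [lra | assumption]).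
      assert (ln := locally_nonreal b n); revert ln; apply filter_imp.
      intros w nw rw; symmetry; apply strip_extend_right with T; auto.
      right; shift_simpl; assumption.
  + auto.
  + intros l; assert (n : Im b <> 0%R) by (destruct hb as [[h|h] _]; [lra | assumption]).
    assert (ln := locally_nonreal b n); revert ln; apply filter_imp.
    intros w nw rw; destruct Rle_dec as [l'|l']; [lra|].
    apply strip_extend_left with T; auto.
    right; assumption.
Qed.
(** * Symmetry and growth of the continuation *)

Lemma branch_poly_reflect b : branch_poly (2 * PI - b) = branch_poly b.
Proof. rewrite !branch_polyE; apply C_eq; simpl; field. Qed.

(** The reflection about pi maps the triplet at [b] to the one at
    [- 2pi - b] in reverse order, and the minus sign in front of the third root is
    compensated by [outer_root_reflect]. *)
Lemma T_reflect_left lambda T b s : OneDSt lambda T ->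
  Im b <> 0%R -> - 3 * PI <= Re b <= - PI -> s * s = branch_poly b ->
  T b s = T (2 * PI - b) s.
Proof.
intros hT hi hr hs; assert (p := PI_RGT_0).
assert (d : triplet_start b) by (right; assumption).
destruct (triplet_start_domains b d) as [d0 [d2 d4]].
destruct (sheet_sign_outer b s d0 hs) as [eps [he ->]].
assert (d' : triplet_start (2 * PI - (b + 4 * PI))) by (right; C_lra).
assert (h := stencil_relation _ _ _ _ hT d he).
assert (h' := stencil_relation _ _ _ _ hT d' he).
replace (2 * PI - (b + 4 * PI) + 4 * PI) with (2 * PI - b) in h' by ring.
replace (2 * PI - (b + 4 * PI) + 2 * PI) with (2 * PI - (b + 2 * PI)) in h' by ring.
rewrite !outer_root_reflect, inner_root_reflect in h' by assumption.
replace (- (eps * - outer_root b)) with (eps * outer_root b) in h' by ring.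
replace (eps * - outer_root (b + 4 * PI)) with (- (eps * outer_root (b + 4 * PI))) in h' by ring.
rewrite <- (OneDSt4 _ _ hT (b + 2 * PI)), <- (OneDSt4 _ _ hT (b + 4 * PI)) in h';
  [ | unfold strip; shift_simpl; lra | now apply opp_signed_root_sqr, outer_root_sqr
    | unfold strip; shift_simpl; lra | now apply signed_root_sqr, inner_root_sqr].
rewrite <- h in h'.
apply Cminus_eq_0.
match type of h' with ?l = ?r => transitivity (r - l); [ring | rewrite h'; ring] end.
Qed.

Lemma T_reflect lambda T b s : OneDSt lambda T ->
  wide_domain b -> s * s = branch_poly b -> T b s = T (2 * PI - b) s.
Proof.
intros hT [hd hr] hs; assert (p := PI_RGT_0).
destruct (Rlt_le_dec (Re b) (- PI)) as [l|l].
  apply (T_reflect_left lambda); auto; [|lra].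
  destruct hd as [h|h]; [unfold strip in h; lra | assumption].
destruct (Rlt_le_dec (3 * PI) (Re b)) as [r|r].
  assert (e : Re (2 * PI - b) = (2 * PI - Re b)%R) by (unfold Re; simpl; ring).
  assert (i : Im (2 * PI - b) = (- Im b)%R) by (unfold Im; simpl; ring).
  rewrite (T_reflect_left lambda T (2 * PI - b)); auto.
  - f_equal; ring.
  - rewrite i; destruct hd as [h|h]; [unfold strip in h; lra | lra].
  - lra.
  - rewrite branch_poly_reflect; assumption.
apply (OneDSt4 _ _ hT); [unfold strip; lra | assumption].
Qed.

Lemma T_growth_left lambda T C0 kappa b s : OneDSt lambda T ->
  (forall b s, strip b -> s * s = branch_poly b ->
     Cmod (T b s) <= C0 * exp (kappa * Rabs (Im b))) ->
  Im b <> 0%R -> - 3 * PI <= Re b <= - PI -> s * s = branch_poly b ->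
  Cmod (T b s) <= (Cmod lambda + 1) * C0 * exp (kappa * Rabs (Im b)).
Proof.
intros hT hC hi hr hs; assert (p := PI_RGT_0).
assert (d : triplet_start b) by (right; assumption).
destruct (triplet_start_domains b d) as [d0 _].
destruct (sheet_sign_outer b s d0 hs) as [eps [he ->]].
assert (h := stencil_relation _ _ _ _ hT d he).
assert (g2 := hC (b + 2 * PI) (eps * inner_root (b + 2 * PI))).
assert (g4 := hC (b + 4 * PI) (- (eps * outer_root (b + 4 * PI)))).
revert g2 g4; unfold strip; shift_simpl; intros g2 g4.
assert (h2 : Cmod (T (b + 2 * PI) (eps * inner_root (b + 2 * PI))) <= C0 * exp (kappa * Rabs (Im b)))
  by (apply g2; [lra | now apply signed_root_sqr, inner_root_sqr]).
assert (h4 : Cmod (T (b + 4 * PI) (- (eps * outer_root (b + 4 * PI)))) <= C0 * exp (kappa * Rabs (Im b)))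
  by (apply g4; [lra | now apply opp_signed_root_sqr, outer_root_sqr]).
set (X := T b _) in *; set (Y := T (b + 4 * PI) _) in *; set (Z := T (b + 2 * PI) _) in *.
replace X with (lambda * Z + - Y) by (rewrite <- h; ring).
eapply Rle_trans; [apply Cmod_triangle|]; rewrite Cmod_mult, Cmod_opp.
assert (a := Rmult_le_compat_l _ _ _ (Cmod_ge_0 lambda) h2); lra.
Qed.

Lemma T_growth lambda T : OneDSt lambda T -> exists K kappa : R, 0 <= K /\ 0 <= kappa /\
  forall b s, wide_domain b -> s * s = branch_poly b ->
    Cmod (T b s) <= K * exp (kappa * Rabs (Im b)).
Proof.
intros hT; assert (p := PI_RGT_0); destruct (OneDSt3 _ _ hT) as [C0 [kappa hC]].
assert (C0p : 0 < C0).
  assert (h : strip PI) by (unfold strip; simpl; lra).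
  specialize (hC PI (inner_root PI) h (inner_root_sqr _)).
  assert (m := Cmod_ge_0 (T PI (inner_root PI))).
  assert (e := exp_pos (kappa * Rabs (Im PI))); nra.
assert (mono : forall x, exp (kappa * Rabs x) <= exp (Rabs kappa * Rabs x)).
  intros x; assert (a := Rle_abs kappa); assert (b := Rabs_pos x).
  assert (c : kappa * Rabs x <= Rabs kappa * Rabs x) by (apply Rmult_le_compat_r; lra).
  destruct c as [c|c]; [apply Rlt_le, exp_increasing, c | rewrite c; lra].
assert (hC' : forall b s, strip b -> s * s = branch_poly b ->
    Cmod (T b s) <= C0 * exp (Rabs kappa * Rabs (Im b))).
  intros b s hb hs; specialize (hC b s hb hs); specialize (mono (Im b)).
  assert (a := Rmult_le_compat_l _ _ _ (Rlt_le _ _ C0p) mono); lra.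
assert (L := Cmod_ge_0 lambda).
exists ((Cmod lambda + 1) * C0)%R, (Rabs kappa); split; [nra|]; split; [apply Rabs_pos|].
intros b s [hd hr] hs.
destruct (Rlt_le_dec (Re b) (- PI)) as [l|l].
  apply T_growth_left; auto; [|lra].
  destruct hd as [h|h]; [unfold strip in h; lra | assumption].
destruct (Rlt_le_dec (3 * PI) (Re b)) as [r|r].
  assert (e : Re (2 * PI - b) = (2 * PI - Re b)%R) by (unfold Re; simpl; ring).
  assert (i : Im (2 * PI - b) = (- Im b)%R) by (unfold Im; simpl; ring).
  rewrite (T_reflect lambda T b s hT (conj hd hr) hs), <- (Rabs_Ropp (Im b)), <- i.
  apply T_growth_left; auto.
  - rewrite i; destruct hd as [h|h]; [unfold strip in h; lra | lra].
  - lra.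
  - rewrite branch_poly_reflect; assumption.
assert (a := hC' b s ltac:(unfold strip; lra) hs).
assert (q := exp_pos (Rabs kappa * Rabs (Im b))).
assert (0 <= Cmod lambda * (C0 * exp (Rabs kappa * Rabs (Im b)))).
  repeat apply Rmult_le_pos; lra.
lra.
Qed.
(** * The sheets fixed by continuity *)

(** The sheets on the two-step paths of [fixed_sheet], by target of the first step:
    -pi reached above -pi/2, 3pi reached below 5pi/2, or pi again without passing a
    branch point. *)
Lemma sheet_over_mPI (b1 b2 r p : R -> C) (eps : C) :
  path b1 -> path b2 ->
  root_along (fun t => branch_poly (b1 t)) r -> root_along (fun t => branch_poly (b2 t)) p ->
  eps * eps = 1 -> b1 0%R = PI -> b1 1%R = - PI -> b2 0%R = - PI ->
  (forall t, 0 <= t <= 1 -> 0 <= Im (b1 t)) ->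
  (forall t, 0 <= t <= 1 -> off_segment (b2 t)) ->
  r 0%R = eps * inner_root PI -> p 0%R = r 1%R -> p 1%R = eps * outer_root (b2 1%R).
Proof.
intros h1 h2 hr hp he e0 e1 e2 hi ho r0 p0.
apply (outer_sheet_along b2 p eps); auto.
rewrite p0, e2, <- outer_root_mPI, <- e1.
apply upper_sheet_along; auto.
rewrite r0, e0, inner_root_PI; reflexivity.
Qed.

Lemma sheet_over_3PI (b1 b2 r p : R -> C) (eps : C) :
  path b1 -> path b2 ->
  root_along (fun t => branch_poly (b1 t)) r -> root_along (fun t => branch_poly (b2 t)) p ->
  eps * eps = 1 -> b1 0%R = PI -> b1 1%R = 3 * PI -> b2 0%R = 3 * PI ->
  (forall t, 0 <= t <= 1 -> Im (b1 t) <= 0) ->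
  (forall t, 0 <= t <= 1 -> off_segment (b2 t)) ->
  r 0%R = eps * inner_root PI -> p 0%R = r 1%R -> p 1%R = - eps * outer_root (b2 1%R).
Proof.
intros h1 h2 hr hp he e0 e1 e2 hi ho r0 p0.
assert (he' : - eps * - eps = 1) by (rewrite <- he; ring).
apply (outer_sheet_along b2 p (- eps)); auto.
rewrite p0, e2, <- outer_root_3PI, <- e1.
apply lower_sheet_along; auto.
rewrite r0, e0, conj_upper_root_PI, inner_root_PI; ring.
Qed.

Lemma sheet_over_PI (b1 b2 r p : R -> C) (eps : C) :
  path b1 -> path b2 ->
  root_along (fun t => branch_poly (b1 t)) r -> root_along (fun t => branch_poly (b2 t)) p ->
  eps * eps = 1 -> b1 0%R = PI -> b2 0%R = b1 1%R ->
  (forall t, 0 <= t <= 1 -> - PI / 2 < Re (b1 t) < 5 * PI / 2) ->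
  (forall t, 0 <= t <= 1 -> - PI / 2 < Re (b2 t) < 5 * PI / 2) ->
  r 0%R = eps * inner_root PI -> p 0%R = r 1%R -> p 1%R = eps * inner_root (b2 1%R).
Proof.
intros h1 h2 hr hp he e0 e2 hi ho r0 p0.
apply (inner_sheet_along b2 p eps); auto.
  intros t ht; right; auto.
rewrite p0, e2; apply inner_sheet_along; auto.
  intros t ht; right; auto.
rewrite r0, e0; reflexivity.
Qed.

Lemma m_shifted_re k e c : 0 < Im k -> m_shifted k e c ->
  Re c = (gamma_re k (Im c) - PI / 2 + if e then 2 * PI else 0)%R.
Proof.
intros hk h; destruct e; unfold m_shifted in h; apply m_minus_re in h; try assumption.
  replace (Re (c - 2 * PI)) with (Re c - 2 * PI)%R in h by (unfold Re; simpl; ring).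
  replace (Im (c - 2 * PI)) with (Im c) in h by (unfold Im; simpl; ring).
  lra.
lra.
Qed.

(** The root carried by [a1 + a2] over the sets indexed by [e1], [e2]; since
    [a1 - a2 + PI] is the sum of [a1] and [PI - a2], the same table with [e2]
    negated describes the root carried by the difference. *)
Definition sum_sheet (e1 e2 : bool) (eps b : C) : C :=
  match e1, e2 with
  | false, false => eps * outer_root b
  | true, true => - eps * outer_root b
  | _, _ => eps * inner_root b
  end.

Lemma Re_sum a b : Re (a + b) = (Re a + Re b)%R.
Proof. reflexivity. Qed.
Lemma Im_sum a b : Im (a + b) = (Im a + Im b)%R.
Proof. reflexivity. Qed.
Lemma Re_diff a b : Re (a - b + PI) = (Re a - Re b + PI)%R.
Proof. reflexivity. Qed.
Lemma Im_diff a b : Im (a - b + PI) = (Im a - Im b)%R.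
Proof. unfold Im; simpl; ring. Qed.
Lemma Re_flip e a : Re (flip e a) = (if e then PI - Re a else Re a)%R.
Proof. destruct e; [apply Re_PI_minus | reflexivity]. Qed.
Lemma Im_flip e a : Im (flip e a) = (if e then - Im a else Im a)%R.
Proof. destruct e; [apply Im_PI_minus | reflexivity]. Qed.

Ltac components :=
  rewrite ?Re_diff, ?Im_diff, ?Re_sum, ?Im_sum, ?Re_flip, ?Im_flip.

Lemma fixed_sheet_values k e1 e2 s1 s2 x1 x2 z1 z2 eps1 eps2 : 0 < Im k ->
  eps1 * eps1 = 1 -> eps2 * eps2 = 1 ->
  s1 = eps1 * inner_root PI -> s2 = eps2 * inner_root PI ->
  fixed_sheet k e1 e2 s1 s2 x1 x2 z1 z2 ->
  z1 = sum_sheet e1 e2 eps1 (x1 + x2) /\ z2 = sum_sheet e1 (negb e2) eps2 (x1 - x2 + PI).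
Proof.
intros hk he1 he2 hs1 hs2 [a1 [a2 [r1 [r2 [c1 [c2 [p1 [p2 h]]]]]]]].
destruct h as [href [hlift [r10 [r20 [hlift' [hm [c10 [c20 [p10 [p20 [<- [<- [<- <-]]]]]]]]]]]]].
destruct href as [_ [_ [a10 [a20 [a11 [a21 hreg]]]]]].
destruct hlift as [ha1 [ha2 [hr1 hr2]]]; destruct hlift' as [hc1 [hc2 [hp1 hp2]]].
assert (p := PI_RGT_0).
rewrite a11 in c10; rewrite a21 in c20.
rewrite hs1 in r10; rewrite hs2 in r20.
assert (hsum : path (fun t => flip e1 (a1 t) + flip e2 (a2 t)))
  by (intros t ht; apply continuous_Cplus; auto).
assert (hdif : path (fun t => flip e1 (a1 t) - flip e2 (a2 t) + PI))
  by (intros t ht; apply continuous_Cplus; [apply continuous_Cminus; auto | apply continuous_const]).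
assert (hsum' : path (fun t => c1 t + c2 t))
  by (intros t ht; apply continuous_Cplus; auto).
assert (hdif' : path (fun t => c1 t - c2 t + PI))
  by (intros t ht; apply continuous_Cplus; [apply continuous_Cminus; auto | apply continuous_const]).
assert (creg : forall t, 0 <= t <= 1 ->
   - (PI / 2) < gamma_re k (Im (c1 t)) < PI / 2 /\ - (PI / 2) < gamma_re k (Im (c2 t)) < PI / 2 /\
   (Im (c1 t) = - Im (c2 t) -> gamma_re k (Im (c1 t)) = - gamma_re k (Im (c2 t)))%R /\
   (Im (c1 t) = Im (c2 t) -> gamma_re k (Im (c1 t)) = gamma_re k (Im (c2 t)))%R /\
   Re (c1 t) = (gamma_re k (Im (c1 t)) - PI / 2 + if e1 then 2 * PI else 0)%R /\
   Re (c2 t) = (gamma_re k (Im (c2 t)) - PI / 2 + if e2 then 2 * PI else 0)%R).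
  intros t ht; destruct (hm t ht) as [m1 m2].
  split; [apply gamma_re_bound|]; split; [apply gamma_re_bound|].
  split; [intros ->; apply gamma_re_opp|]; split; [intros ->; reflexivity|].
  split; now apply m_shifted_re.
assert (areg : forall t, 0 <= t <= 1 -> 0 <= Im (a1 t) + Im (a2 t) /\
   - (3 * PI / 2) < Re (a1 t) - Re (a2 t) < 3 * PI / 2).
  intros t ht; destruct (hreg t ht) as [_ [i1 [_ i2]]].
  split; [exact i1|].
  replace (Re (a1 t - a2 t)) with (Re (a1 t) - Re (a2 t))%R in i2 by reflexivity.
  apply Rabs_def2 in i2; lra.
(* In each case the first step has one of the three shapes above; what is left is the
   location of the paths, where the real case follows from oddness of [gamma_re]. *)
destruct e1, e2; simpl sum_sheet; split;
 first [ apply (sheet_over_mPI _ _ _ _ eps1 hsum hsum' hr1 hp1)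
       | apply (sheet_over_3PI _ _ _ _ eps1 hsum hsum' hr1 hp1)
       | apply (sheet_over_PI _ _ _ _ eps1 hsum hsum' hr1 hp1)
       | apply (sheet_over_mPI _ _ _ _ eps2 hdif hdif' hr2 hp2)
       | apply (sheet_over_3PI _ _ _ _ eps2 hdif hdif' hr2 hp2)
       | apply (sheet_over_PI _ _ _ _ eps2 hdif hdif' hr2 hp2) ];
 try eassumption;
 try (rewrite ?a10, ?a20, ?a11, ?a21, ?c10, ?c20; apply C_eq; simpl; field);
 intros t ht; destruct (areg t ht) as [A1 A2]; destruct (creg t ht) as [B1 [B2 [B3 [B4 [B5 B6]]]]];
 unfold off_segment; components; try lra.
all: match goal with |- ?i <> _ \/ _ => destruct (Req_dec i 0) as [z|z]; [right | left; assumption] end.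
all: first [ assert (B3' := B3 ltac:(lra)); lra | assert (B4' := B4 ltac:(lra)); lra ].
Qed.
(** * The stencil formulation for a product *)

Lemma reference_sheets s1 s2 : sheet (PI / 2) (PI / 2) s1 s2 ->
  exists eps1 eps2, eps1 * eps1 = 1 /\ eps2 * eps2 = 1 /\
    s1 = eps1 * inner_root PI /\ s2 = eps2 * inner_root PI.
Proof.
assert (p := PI_RGT_0); intros [h1 h2].
replace (PI / 2 + PI / 2) with (RtoC PI) in h1 by (apply C_eq; simpl; field).
replace (PI / 2 - PI / 2 + PI) with (RtoC PI) in h2 by (apply C_eq; simpl; field).
assert (nz : inner_root PI <> 0).
  intros e; apply (off_rays_neq PI).
    right; simpl; lra.
  rewrite <- inner_root_sqr, e; ring.
rewrite <- inner_root_sqr in h1, h2.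
destruct (square_root_sign _ _ h1 nz) as [eps1 [he1 e1]].
destruct (square_root_sign _ _ h2 nz) as [eps2 [he2 e2]].
exists eps1, eps2; auto.
Qed.

Lemma m_minus_sums k a1 a2 : 0 < Im k -> m_minus k a1 -> m_minus k a2 ->
  triplet_start (a1 + a2) /\ triplet_start (a1 - a2 - PI) /\
  wide_domain (a1 + a2) /\ wide_domain (a1 - a2 + PI) /\
  off_rays (a1 - a2 + PI).
Proof.
intros hk h1 h2; assert (p := PI_RGT_0).
apply m_minus_re in h1; [|assumption]; apply m_minus_re in h2; [|assumption].
assert (g1 := gamma_re_bound k (Im a1)); assert (g2 := gamma_re_bound k (Im a2)).
assert (d1 : triplet_start (a1 + a2)).
  destruct (Req_dec (Im a1 + Im a2) 0) as [e|n]; [left | right; exact n].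
  assert (i : Im a1 = (- Im a2)%R) by lra; rewrite i, gamma_re_opp in h1.
  apply C_eq; [rewrite Re_sum | rewrite Im_sum]; simpl; lra.
split; [assumption|]; split; [|split; [|split]].
- destruct (Req_dec (Im a1 - Im a2) 0) as [e|n].
    assert (i : Im a1 = Im a2) by lra; rewrite i in h1.
    left; apply C_eq; C_lra.
  right; intros e; apply n; C_lra.
- split; [|components; lra].
  destruct d1 as [->|n]; [left; unfold strip; simpl; lra | right; assumption].
- split; [left; unfold strip|]; components; lra.
- right; components; lra.
Qed.

Lemma locally_wide_interior b : wide_interior b -> locally b wide_interior.
Proof.
intros [h [r1 r2]].
assert (lt : forall c, Re b < c -> locally b (fun w => Re w < c))
  by (intros c hc; apply (continuous_Re_comp _ _ (continuous_id b) _ (open_lt c _ hc))).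
assert (gt : forall c, c < Re b -> locally b (fun w => c < Re w))
  by (intros c hc; apply (continuous_Re_comp _ _ (continuous_id b) _ (open_gt c _ hc))).
apply filter_and; [|apply filter_and; auto].
destruct h as [[h1 h2]|h].
  assert (n := filter_and _ _ (gt _ h1) (lt _ h2)); revert n; apply filter_imp; auto.
assert (n := locally_nonreal b h); revert n; apply filter_imp; auto.
Qed.

Lemma stencil_product_StF1 k lambda T : 0 < Im k -> OneDSt lambda T ->
  exists B : C * C -> C,
    (forall x : C * C, Omega_all k x ->
       holomorphic_at (U := prod_NormedModule C_AbsRing C_NormedModule C_NormedModule) B x) /\
    (forall x : C * C, Omega_all_closed k x ->
       filterlim B (within (Omega_all_closed k) (locally x)) (locally (B x))) /\
    (forall a1 a2 s1 s2 : C, Omega_all_closed k (a1, a2) -> sheet a1 a2 s1 s2 ->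
       stencil_product T a1 a2 s1 s2 = s1 * s2 * B (a1, a2)).
Proof.
intros hk hT; destruct (OneDSt_extension _ _ hT) as [E [hE [cE dE]]].
assert (csum : forall x : C * C, continuous (fun y : C * C => fst y + snd y) x)
  by (intros x; apply continuous_Cplus; [apply continuous_fst | apply continuous_snd]).
assert (cdif : forall x : C * C, continuous (fun y : C * C => fst y - snd y + PI) x).
  intros x; apply continuous_Cplus; [|apply continuous_const].
  apply continuous_Cminus; [apply continuous_fst | apply continuous_snd].
exists (fun y => E (fst y + snd y) * E (fst y - snd y + PI)); split; [|split].
- intros [a1 a2] hx; apply Omega_all_sum in hx; [|assumption]; destruct hx as [h1 h2].
  assert (n1 := csum (a1, a2) _ (locally_wide_interior _ h1)).
  assert (n2 := cdif (a1, a2) _ (locally_wide_interior _ h2)).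
  unfold filtermap in n1, n2; assert (n := filter_and _ _ n1 n2).
  unfold holomorphic_at; revert n; apply filter_imp; intros y [h3 h4]; apply ex_filterdiff_product; auto.
- intros [a1 a2] hx; apply Omega_all_closed_sum in hx; [|assumption]; destruct hx as [h1 h2].
  eapply filterlim_filter_le_1; [apply filter_le_within|].
  apply (continuous_Cmult (fun y : C * C => E (fst y + snd y)) (fun y : C * C => E (fst y - snd y + PI))).
    apply (continuous_comp (fun y : C * C => fst y + snd y) E); auto.
  apply (continuous_comp (fun y : C * C => fst y - snd y + PI) E); auto.
- intros a1 a2 s1 s2 hx [hs1 hs2]; apply Omega_all_closed_sum in hx; [|assumption].
  destruct hx as [h1 h2]; unfold stencil_product; simpl.
  rewrite (hE _ _ h1 hs1), (hE _ _ h2 hs2); ring.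
Qed.

(** The relations at [a1 + a2] and at [a1 - a2 - PI], each multiplied by the middle
    term of the other, have the same right-hand side. *)
Lemma stencil_product_StF2 k lambda T : 0 < Im k -> OneDSt lambda T ->
  forall s1 s2 : C, sheet (PI / 2) (PI / 2) s1 s2 ->
  forall a1 a2 : C, m_minus k a1 -> m_minus k a2 ->
  forall w w11 w01 w10 : C,
    fixed_value k (stencil_product T) false false s1 s2 a1 a2 w ->
    fixed_value k (stencil_product T) true true s1 s2 (2 * PI + a1) (2 * PI + a2) w11 ->
    fixed_value k (stencil_product T) false true s1 s2 a1 (2 * PI + a2) w01 ->
    fixed_value k (stencil_product T) true false s1 s2 (2 * PI + a1) a2 w10 ->
    w + w11 - w01 - w10 = 0.
Proof.
intros hk hT s1 s2 hs a1 a2 ha1 ha2 w w11 w01 w10.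
intros [z1 [z2 [f ->]]] [z1' [z2' [f' ->]]] [y1 [y2 [g ->]]] [y1' [y2' [g' ->]]].
destruct (reference_sheets _ _ hs) as [eps1 [eps2 [he1 [he2 [hs1 hs2]]]]].
destruct (m_minus_sums k a1 a2 hk ha1 ha2) as [d1 [d2 _]].
destruct (fixed_sheet_values _ _ _ _ _ _ _ _ _ _ _ hk he1 he2 hs1 hs2 f) as [-> ->].
destruct (fixed_sheet_values _ _ _ _ _ _ _ _ _ _ _ hk he1 he2 hs1 hs2 f') as [-> ->].
destruct (fixed_sheet_values _ _ _ _ _ _ _ _ _ _ _ hk he1 he2 hs1 hs2 g) as [-> ->].
destruct (fixed_sheet_values _ _ _ _ _ _ _ _ _ _ _ hk he1 he2 hs1 hs2 g') as [-> ->].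
assert (r1 := stencil_relation _ _ _ _ hT d1 he1).
assert (r2 := stencil_relation _ _ _ _ hT d2 he2).
unfold stencil_product; simpl sum_sheet.
replace (2 * PI + a1 + (2 * PI + a2)) with (a1 + a2 + 4 * PI) by ring.
replace (2 * PI + a1 - (2 * PI + a2) + PI) with (a1 - a2 - PI + 2 * PI) by ring.
replace (a1 + (2 * PI + a2)) with (a1 + a2 + 2 * PI) by ring.
replace (a1 - (2 * PI + a2) + PI) with (a1 - a2 - PI) by ring.
replace (2 * PI + a1 + a2) with (a1 + a2 + 2 * PI) by ring.
replace (2 * PI + a1 - a2 + PI) with (a1 - a2 - PI + 4 * PI) by ring.
replace (a1 - a2 + PI) with (a1 - a2 - PI + 2 * PI) by ring.
replace (- eps1 * outer_root (a1 + a2 + 4 * PI)) with (- (eps1 * outer_root (a1 + a2 + 4 * PI))) by ring.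
replace (- eps2 * outer_root (a1 - a2 - PI + 4 * PI))
  with (- (eps2 * outer_root (a1 - a2 - PI + 4 * PI))) by ring.
set (X1 := T (a1 + a2) _) in *; set (X3 := T (a1 + a2 + 4 * PI) _) in *.
set (X2 := T (a1 + a2 + 2 * PI) _) in *.
set (Y1 := T (a1 - a2 - PI) _) in *; set (Y3 := T (a1 - a2 - PI + 4 * PI) _) in *.
set (Y2 := T (a1 - a2 - PI + 2 * PI) _) in *.
transitivity ((X1 + X3) * Y2 - X2 * (Y1 + Y3)); [ring|].
rewrite r1, r2; ring.
Qed.

(** After [T_reflect] all four values are the same product, except that the signs
    [eps1] and [eps2] may be attached to either factor; as [T] is odd in the root,
    only their product counts. *)
Lemma stencil_product_StF3 k lambda T : 0 < Im k -> OneDSt lambda T ->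
  forall s1 s2 : C, sheet (PI / 2) (PI / 2) s1 s2 ->
  forall a1 a2 : C, m_minus k a1 -> m_minus k a2 ->
  forall w w11 w01 w10 : C,
    fixed_value k (stencil_product T) false false s1 s2 a1 a2 w ->
    fixed_value k (stencil_product T) true false s1 s2 (PI - a1) a2 w10 ->
    fixed_value k (stencil_product T) false true s1 s2 a1 (PI - a2) w01 ->
    fixed_value k (stencil_product T) true true s1 s2 (PI - a1) (PI - a2) w11 ->
    w = w10 /\ w10 = w01 /\ w01 = w11.
Proof.
intros hk hT s1 s2 hs a1 a2 ha1 ha2 w w11 w01 w10.
intros [z1 [z2 [f ->]]] [z1' [z2' [f' ->]]] [y1 [y2 [g ->]]] [y1' [y2' [g' ->]]].
destruct (OneDSt_extension _ _ hT) as [E [hE _]].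
destruct (reference_sheets _ _ hs) as [eps1 [eps2 [he1 [he2 [hs1 hs2]]]]].
destruct (m_minus_sums k a1 a2 hk ha1 ha2) as [d1 [_ [w1 [w2 o2]]]].
destruct (triplet_start_domains _ d1) as [o1 _].
destruct (fixed_sheet_values _ _ _ _ _ _ _ _ _ _ _ hk he1 he2 hs1 hs2 f) as [-> ->].
destruct (fixed_sheet_values _ _ _ _ _ _ _ _ _ _ _ hk he1 he2 hs1 hs2 f') as [-> ->].
destruct (fixed_sheet_values _ _ _ _ _ _ _ _ _ _ _ hk he1 he2 hs1 hs2 g) as [-> ->].
destruct (fixed_sheet_values _ _ _ _ _ _ _ _ _ _ _ hk he1 he2 hs1 hs2 g') as [-> ->].
unfold stencil_product; simpl sum_sheet.
replace (PI - a1 + a2) with (2 * PI - (a1 - a2 + PI)) by (apply C_eq; simpl; ring).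
replace (PI - a1 - a2 + PI) with (2 * PI - (a1 + a2)) by (apply C_eq; simpl; ring).
replace (a1 + (PI - a2)) with (a1 - a2 + PI) by ring.
replace (a1 - (PI - a2) + PI) with (a1 + a2) by ring.
replace (PI - a1 + (PI - a2)) with (2 * PI - (a1 + a2)) by (apply C_eq; simpl; ring).
replace (PI - a1 - (PI - a2) + PI) with (2 * PI - (a1 - a2 + PI)) by (apply C_eq; simpl; ring).
rewrite !outer_root_reflect, !inner_root_reflect by assumption.
replace (- eps1 * - outer_root (a1 + a2)) with (eps1 * outer_root (a1 + a2)) by ring.
replace (- eps2 * - outer_root (a1 + a2)) with (eps2 * outer_root (a1 + a2)) by ring.
assert (q1 := signed_root_sqr _ _ _ he1 (outer_root_sqr (a1 + a2))).
assert (q2 := signed_root_sqr _ _ _ he2 (outer_root_sqr (a1 + a2))).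
assert (q3 := signed_root_sqr _ _ _ he1 (inner_root_sqr (a1 - a2 + PI))).
assert (q4 := signed_root_sqr _ _ _ he2 (inner_root_sqr (a1 - a2 + PI))).
rewrite <- (T_reflect _ _ _ _ hT w1 q1), <- (T_reflect _ _ _ _ hT w1 q2).
rewrite <- (T_reflect _ _ _ _ hT w2 q3), <- (T_reflect _ _ _ _ hT w2 q4).
rewrite (hE _ _ w1 q1), (hE _ _ w1 q2), (hE _ _ w2 q3), (hE _ _ w2 q4).
split; [|split]; ring.
Qed.

Lemma Omega_all_closed_M k z1 z2 : M k z1 -> M k z2 -> Omega_all_closed k (z1, z2).
Proof. intros h1 h2; exists false, false; split; left; assumption. Qed.

Lemma stencil_product_StF4 k lambda T : 0 < Im k -> OneDSt lambda T ->
  exists mu : R, forall a1 a2 d1 d2 : R, (d1 * d1 + d2 * d2 = 1)%R ->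
    exists Lambda0 : R, forall Lambda : R, 0 < Lambda -> Lambda0 < Lambda ->
      forall z1 z2 s1 s2 : C,
        z1 = (a1, (Lambda * d1)%R) -> z2 = (a2, (Lambda * d2)%R) ->
        ((M_plus k z1 /\ M k z2) \/ (M k z1 /\ M_plus k z2)) \/
          (M_minus k z1 /\ M_minus k z2) ->
        sheet z1 z2 s1 s2 ->
        Cmod (stencil_product T z1 z2 s1 s2) < exp (mu * Lambda).
Proof.
intros hk hT; destruct (T_growth _ _ hT) as [K [kappa [hK [hkappa hg]]]].
(* Both arguments of [T] have imaginary part at most [2 * L] in absolute value, so the
   product is at most [K * K * exp (4 * kappa * L)], and [K * K < exp L] for [K * K < L]. *)
exists (4 * kappa + 1)%R; intros a1 a2 d1 d2 hd.
exists (K * K)%R; intros L hL hL0 z1 z2 s1 s2 e1 e2 hM [hs1 hs2].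
assert (hO : Omega_all_closed k (z1, z2)).
  apply Omega_all_closed_M; unfold M in *; tauto.
apply Omega_all_closed_sum in hO; [|assumption]; destruct hO as [w1 w2].
assert (hd1 : -1 <= d1 <= 1) by nra; assert (hd2 : -1 <= d2 <= 1) by nra.
assert (bound : forall b s, wide_domain b -> s * s = branch_poly b ->
   Rabs (Im b) <= 2 * L -> Cmod (T b s) <= K * exp (2 * kappa * L)).
  intros b s hb hs hi; eapply Rle_trans; [apply (hg b s hb hs)|].
  apply Rmult_le_compat_l; [assumption|].
  assert (c : kappa * Rabs (Im b) <= 2 * kappa * L) by nra.
  destruct c as [c|c]; [apply Rlt_le, exp_increasing, c | rewrite c; lra].
assert (b1 : Cmod (T (z1 + z2) s1) <= K * exp (2 * kappa * L)).
  apply bound; try assumption; rewrite Im_sum, e1, e2; simpl; apply Rabs_le; nra.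
assert (b2 : Cmod (T (z1 - z2 + PI) s2) <= K * exp (2 * kappa * L)).
  apply bound; try assumption; rewrite Im_diff, e1, e2; simpl; apply Rabs_le; nra.
unfold stencil_product; rewrite Cmod_mult.
apply Rle_lt_trans with (K * K * exp (4 * kappa * L))%R.
  replace (K * K * exp (4 * kappa * L))%R
    with (K * exp (2 * kappa * L) * (K * exp (2 * kappa * L)))%R.
    apply Rmult_le_compat; auto using Cmod_ge_0.
  replace (4 * kappa * L)%R with (2 * kappa * L + 2 * kappa * L)%R by ring.
  rewrite exp_plus; ring.
replace ((4 * kappa + 1) * L)%R with (L + 4 * kappa * L)%R by ring.
rewrite exp_plus; apply Rmult_lt_compat_r; [apply exp_pos|].
assert (e := exp_ineq1 L); lra.
Qed.

Lemma StF_stencil_product k lambda T : 0 < Im k -> OneDSt lambda T ->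
  StF k (stencil_product T).
Proof.
intros hk hT; split.
- now apply stencil_product_StF1 with lambda.
- now apply stencil_product_StF2 with lambda.
- now apply stencil_product_StF3 with lambda.
- now apply stencil_product_StF4 with lambda.
Qed.

(** * Linear combinations *)

Lemma ex_filterdiff_linear (c : C) (f g : C * C -> C) x :
  ex_filterdiff (U := prod_NormedModule C_AbsRing C_NormedModule C_NormedModule)
    (V := C_NormedModule) f (locally x) ->
  ex_filterdiff (U := prod_NormedModule C_AbsRing C_NormedModule C_NormedModule)
    (V := C_NormedModule) g (locally x) ->
  ex_filterdiff (U := prod_NormedModule C_AbsRing C_NormedModule C_NormedModule)
    (V := C_NormedModule) (fun y => f y + c * g y) (locally x).
Proof.
intros hf hg; apply (ex_filterdiff_plus_fct (V := C_NormedModule)); [assumption|].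
apply (ex_filterdiff_scal_r_fct (V := C_NormedModule)); [|assumption].
intros; apply Cmult_comm.
Qed.

Lemma StF_zero k : StF k (fun _ _ _ _ => 0).
Proof.
split.
- exists (fun _ => 0); split; [|split].
  + intros x _; unfold holomorphic_at; apply filter_forall; intros y; exists (fun _ => zero); apply filterdiff_const.
  + intros x _; apply filterlim_const.
  + intros; ring.
- intros s1 s2 _ a1 a2 _ _ w w11 w01 w10 [? [? [_ ->]]] [? [? [_ ->]]] [? [? [_ ->]]] [? [? [_ ->]]].
  ring.
- intros s1 s2 _ a1 a2 _ _ w w11 w01 w10 [? [? [_ ->]]] [? [? [_ ->]]] [? [? [_ ->]]] [? [? [_ ->]]].
  auto.
- exists 0%R; intros a1 a2 d1 d2 _; exists 0%R; intros; rewrite Cmod_0; apply exp_pos.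
Qed.

(** The sheets in [StF2] and [StF3] depend on the paths only, so the same values of the
    roots serve for [W] and [V]. *)
Lemma StF_linear k c W V : StF k W -> StF k V ->
  StF k (fun a1 a2 s1 s2 => W a1 a2 s1 s2 + c * V a1 a2 s1 s2).
Proof.
intros hW hV; split.
- destruct (StF1 _ _ hW) as [B [b1 [b2 b3]]]; destruct (StF1 _ _ hV) as [D [d1 [d2 d3]]].
  exists (fun x => B x + c * D x); split; [|split].
  + intros x hx; assert (n := filter_and _ _ (b1 x hx) (d1 x hx)).
    unfold holomorphic_at; revert n; apply filter_imp; intros y [h1 h2]; now apply ex_filterdiff_linear.
  + intros x hx.
    apply (filterlim_comp_2 (G := locally (B x)) (H := locally (c * D x)) B (fun y => c * D y) Cplus).
    * now apply b2.
    * apply (filterlim_comp _ _ _ D (fun v => c * v) _ (locally (D x))); [now apply d2|].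
      apply (continuous_Cmult (fun _ => c) (fun v => v)); [apply continuous_const | apply continuous_id].
    * apply (filterlim_plus (V := C_NormedModule)).
  + intros a1 a2 s1 s2 hx hs; rewrite (b3 a1 a2 s1 s2 hx hs), (d3 a1 a2 s1 s2 hx hs); ring.
- intros s1 s2 hs a1 a2 h1 h2 w w11 w01 w10 [? [? [f1 ->]]] [? [? [f2 ->]]] [? [? [f3 ->]]] [? [? [f4 ->]]].
  assert (eW := StF2 _ _ hW s1 s2 hs a1 a2 h1 h2 _ _ _ _
    (ex_intro _ _ (ex_intro _ _ (conj f1 eq_refl))) (ex_intro _ _ (ex_intro _ _ (conj f2 eq_refl)))
    (ex_intro _ _ (ex_intro _ _ (conj f3 eq_refl))) (ex_intro _ _ (ex_intro _ _ (conj f4 eq_refl)))).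
  assert (eV := StF2 _ _ hV s1 s2 hs a1 a2 h1 h2 _ _ _ _
    (ex_intro _ _ (ex_intro _ _ (conj f1 eq_refl))) (ex_intro _ _ (ex_intro _ _ (conj f2 eq_refl)))
    (ex_intro _ _ (ex_intro _ _ (conj f3 eq_refl))) (ex_intro _ _ (ex_intro _ _ (conj f4 eq_refl)))).
  match type of eV with ?v = _ => match type of eW with ?w = _ =>
    transitivity (w + c * v); [ring | rewrite eV, eW; ring] end end.
- intros s1 s2 hs a1 a2 h1 h2 w w11 w01 w10 [? [? [f1 ->]]] [? [? [f2 ->]]] [? [? [f3 ->]]] [? [? [f4 ->]]].
  destruct (StF3 _ _ hW s1 s2 hs a1 a2 h1 h2 _ _ _ _
    (ex_intro _ _ (ex_intro _ _ (conj f1 eq_refl))) (ex_intro _ _ (ex_intro _ _ (conj f2 eq_refl)))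
    (ex_intro _ _ (ex_intro _ _ (conj f3 eq_refl))) (ex_intro _ _ (ex_intro _ _ (conj f4 eq_refl))))
    as [u1 [u2 u3]].
  destruct (StF3 _ _ hV s1 s2 hs a1 a2 h1 h2 _ _ _ _
    (ex_intro _ _ (ex_intro _ _ (conj f1 eq_refl))) (ex_intro _ _ (ex_intro _ _ (conj f2 eq_refl)))
    (ex_intro _ _ (ex_intro _ _ (conj f3 eq_refl))) (ex_intro _ _ (ex_intro _ _ (conj f4 eq_refl))))
    as [v1 [v2 v3]].
  rewrite u1, u2, u3, v1, v2, v3; auto.
- destruct (StF4 _ _ hW) as [mu hmu]; destruct (StF4 _ _ hV) as [nu hnu].
  (* The additional exponent absorbs the factor [1 + Cmod c]. *)
  exists (Rmax mu nu + 1)%R; intros a1 a2 d1 d2 hd.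
  destruct (hmu a1 a2 d1 d2 hd) as [L1 h1]; destruct (hnu a1 a2 d1 d2 hd) as [L2 h2].
  exists (Rmax (Cmod c) (Rmax L1 L2)); intros L hL hLm z1 z2 s1 s2 e1 e2 hM hs.
  assert (m1 := Rmax_l (Cmod c) (Rmax L1 L2)); assert (m2 := Rmax_r (Cmod c) (Rmax L1 L2)).
  assert (m3 := Rmax_l L1 L2); assert (m4 := Rmax_r L1 L2).
  specialize (h1 L hL ltac:(lra) z1 z2 s1 s2 e1 e2 hM hs).
  specialize (h2 L hL ltac:(lra) z1 z2 s1 s2 e1 e2 hM hs).
  assert (mono : forall x, x <= Rmax mu nu -> exp (x * L) <= exp (Rmax mu nu * L)).
    intros x hx; assert (q : x * L <= Rmax mu nu * L) by (apply Rmult_le_compat_r; lra).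
    destruct q as [q|q]; [apply Rlt_le, exp_increasing, q | rewrite q; lra].
  assert (k1 := mono mu (Rmax_l _ _)); assert (k2 := mono nu (Rmax_r _ _)).
  eapply Rle_lt_trans; [apply Cmod_triangle|]; rewrite Cmod_mult.
  replace ((Rmax mu nu + 1) * L)%R with (L + Rmax mu nu * L)%R by ring.
  rewrite exp_plus; assert (e := exp_ineq1 L).
  assert (k3 : Cmod c * Cmod (V z1 z2 s1 s2) <= Cmod c * exp (Rmax mu nu * L))
    by (apply Rmult_le_compat_l; [apply Cmod_ge_0 | lra]).
  assert (k4 : (1 + Cmod c) * exp (Rmax mu nu * L) < exp L * exp (Rmax mu nu * L))
    by (apply Rmult_lt_compat_r; [apply exp_pos | lra]).
  lra.
Qed.

Lemma StF_ext k W V : (forall a1 a2 s1 s2, W a1 a2 s1 s2 = V a1 a2 s1 s2) -> StF k W -> StF k V.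
Proof.
intros e; replace V with W; [auto|].
apply functional_extensionality; intros a1; apply functional_extensionality; intros a2.
apply functional_extensionality; intros s1; apply functional_extensionality; intros s2; auto.
Qed.

Theorem proposition3p5 (k : C) (hRe : (0 < Re k)%R) (hIm : (0 < Im k)%R) :
  (forall (lambda : C) (T : C -> C -> C),
     OneDSt lambda T -> StF k (stencil_product T)) /\
  (forall (n : nat) (lambda c : nat -> C) (T : nat -> C -> C -> C),
     (forall j : nat, (j <= n)%nat -> OneDSt (lambda j) (T j)) ->
     StF k (fun a1 a2 s1 s2 : C =>
       sum_n (fun j : nat => c j * stencil_product (T j) a1 a2 s1 s2) n)).
Proof.
split.
  intros lambda T hT; now apply StF_stencil_product with lambda.
intros n lambda c T hT; induction n as [|n IH].
  apply StF_ext with (fun a1 a2 s1 s2 => 0 + c 0%nat * stencil_product (T 0%nat) a1 a2 s1 s2).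
    intros; rewrite sum_O; ring.
  apply StF_linear; [apply StF_zero | apply StF_stencil_product with (lambda 0%nat); auto].
apply StF_ext with (fun a1 a2 s1 s2 =>
  sum_n (fun j : nat => c j * stencil_product (T j) a1 a2 s1 s2) n
    + c (S n) * stencil_product (T (S n)) a1 a2 s1 s2).
  intros; rewrite sum_Sn; reflexivity.
apply StF_linear; [auto | apply StF_stencil_product with (lambda (S n)); auto].
Qed.
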